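(* Let $Y=(Y(x):x\ge 0)$ be a real-valued Markov process, let $0<a<b<\infty$, and let $c>0$ be the cost per sample. Let $H\in\mathcal{H}$ be a history that includes observations at $a$ and at $b$. Let $x_1<x_2<\dots<x_{t+2}$ be the locations of the observations in $H$ that lie in $[a,b]$, listed in increasing order (so $x_1=a$ and $x_{t+2}=b$), and let $y_1,\dots,y_{t+2}$ be the corresponding observed values. For each $1\le i<t+2$ define $H_i=\{(x_i,y_i),(x_{i+1},y_{i+1})\}$. Then $$V_{[a,b]}(H)=\sum_{i=1}^{t+1}V_{[x_i,x_{i+1}]}(H_i).$$
   Context: **Histories.** $\mathcal{H}=\bigcup_{T=0}^\infty(\mathbb{R}_+\times\mathbb{R})^T$ is the space of histories. A history is regarded as a finite (unordered) set of pairs $(x,y)$, where $(x,y)$ records the observation $Y(x)=y$. Conditioning on $H\in\mathcal{H}$ means conditioning on $Y(x)=y$ for all $(x,y)\in H$. **Policies.** A policy is a measurable function $\pi:\mathcal{H}\to\mathbb{R}_+\cup\{\Delta\}$; $\Delta$ means ''stop''. $\Pi$ is the set of all policies. Starting from an initial history $H_0$, a policy generates $x_{t+1}=\pi(H_t)$, with $H_{t+1}=H_t\cup\{(x_{t+1},Y(x_{t+1}))\}$ if $x_{t+1}\neq\Delta$ and $H_{t+1}=H_t$ if $x_{t+1}=\Delta$ (sampling a point already in the history leaves the history unchanged). The number of samples is $\tau=\inf\{t\ge 0:\pi(H_t)=\Delta\}$ (with $\inf\emptyset=\infty$). $\mathbb{P}^\pi(\cdot\mid H)$ and $\mathbb{E}^\pi[\cdot\mid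 H]$ denote the law and expectation under policy $\pi$ started from initial history $H_0=H$. **Reward.** $I$ is a finite index set, and for $i\in I$, $f_i:\mathbb{R}\to\mathbb{R}$ is a bounded measurable function with $\int_{[a,b]}\mathbb{E}[|f_i(Y(x))|]\,dx<\infty$. For an interval $[\alpha,\beta]$ and $H\in\mathcal{H}$, $$R_{[\alpha,\beta]}(H)=\int_{[\alpha,\beta]}\max_{i\in I}\mathbb{E}[f_i(Y(x))\mid H]\,dx.$$ **Value function.** For an interval $[\alpha,\beta]$ and $H\in\mathcal{H}$, $$V_{[\alpha,\beta]}(H)=\sup_{\pi\in\Pi}\mathbb{E}^\pi[R_{[\alpha,\beta]}(H_\tau)-c\tau\mid H],$$ where a policy with $\mathbb{P}^\pi(\tau=\infty\mid H)>0$ has value $-\infty$ at $H$. *)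

(* Defs.v *)
From HB Require Import structures.
From mathcomp Require Import all_boot all_order all_algebra finmap.
From mathcomp Require Import all_classical all_reals all_analysis measurable_realfun.
Import Order.TTheory GRing.Theory Num.Theory.
Import numFieldNormedType.Exports.

Set Implicit Arguments.
Unset Strict Implicit.
Unset Printing Implicit Defensive.

Local Open Scope classical_set_scope.
Local Open Scope ring_scope.

Section Histories.
Context {R : realType}.

Definition locations (H : {fset R * R}) : {fset R} := [fset p.1 | p in H]%fset.

(* Two different values at one location cannot both be observed, so histories
   are functional; the conditional law given an inconsistent set of
   observations has no meaning. *)
Definition is_history (H : {fset R * R}) : Prop :=
  (forall p, p \in H -> 0 <= p.1) /\
  (forall p q, p \in H -> q \in H -> p.1 = q.1 -> p.2 = q.2).

Definition observe (H : {fset R * R}) (x y : R) : {fset R * R} :=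
  if x \in locations H then H else ((x, y) |` H)%fset.

Definition history_of n (t : n.-tuple (R * R)) : {fset R * R} :=
  [fset p in tval t]%fset.

Definition histories n : set (n.-tuple (R * R)) :=
  [set t | is_history (history_of t)].

(* [None] is the stopping symbol.  Measurability is with respect to the
   sigma-algebra on histories coinduced by the maps [history_of] from the
   n-tuples of observations, for all n, and to the disjoint union
   sigma-algebra on [option R]. *)
Record is_policy (pi : {fset R * R} -> option R) : Prop := {
  policy_ge0 : forall H x, is_history H -> pi H = Some x -> 0 <= x ;
  policy_measurable : forall n (B : set (option R)),
    measurable (Some @^-1` B : set R) ->
    measurable (@histories n `&` [set t | B (pi (history_of t))])
}.

End Histories.

Section Process.
Context {d : measure_display} {T : measurableType d} {R : realType}.
Implicit Types (P : probability T R) (Y : R -> T -> R).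
Implicit Types (cond : {fset R * R} -> probability T R).

(* Only nonnegative times matter; [Y x] is irrelevant for x < 0.  Joint
   measurability makes the observation at a random location a random
   variable. *)
Definition measurable_process Y : Prop :=
  measurable_fun ([set x : R | 0 <= x] `*` [set: T])
    (fun p : R * T => Y p.1 p.2).

Definition path_events Y (J : set R) : set (set T) :=
  <<s \bigcup_(u in J) preimage_set_system [set: T] (Y u) measurable >>.

(* [g (Y s)] is a version of P(Y(t) \in B | Y(u), u <= s), so that this
   conditional probability is a function of Y(s) alone. *)
Definition markov_process P Y : Prop :=
  forall s t : R, 0 <= s -> s <= t ->
  forall B : set R, measurable B ->
  exists g : R -> \bar R,
    [/\ measurable_fun [set: R] g,
        (forall z, (0 <= g z)%E) &
        forall A, path_events Y `[0, s] A ->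
          P (A `&` Y t @^-1` B) = (\int[P]_(w in A) g (Y s w))%E].

(* [cond H] is the law given that Y(x) = y for all (x, y) in H.  Conditioning
   on events of probability zero requires a choice of versions, which must be
   coherent at every history and not merely at almost every one, because
   policies select locations adaptively.  Together, [cond_observed] and
   [cond_disintegration] say that the laws [cond (observe H x y)], y : R, form
   a regular conditional probability of [cond H] given Y(x).  [cond_past] and
   [cond_future] say that the versions respect the Markov property: once Y(s)
   is observed, the past of s is unaffected by the observations after s, and
   the future of s by those before s. *)
Record conditional_laws P Y cond : Prop := {
  cond_measurable : forall n (A : set T), measurable A ->
    measurable_fun (@histories R n) (fun t => cond (history_of t) A) ;
  cond_prior : forall A, measurable A -> cond fset0 A = P A ;
  cond_observed : forall H p, is_history H -> p \in H ->
    cond H (Y p.1 @^-1` [set p.2]) = 1%E ;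
  cond_disintegration : forall H x A, is_history H -> 0 <= x -> measurable A ->
    cond H A = (\int[cond H]_w cond (observe H x (Y x w)) A)%E ;
  cond_past : forall H s A, is_history H -> s \in locations H ->
    path_events Y `[0, s] A ->
    cond H A = cond [fset p in H | p.1 <= s]%fset A ;
  cond_future : forall H s A, is_history H -> s \in locations H ->
    path_events Y `[s, +oo[ A ->
    cond H A = cond [fset p in H | s <= p.1]%fset A
}.

End Process.

Section Sampling.
Context {d : measure_display} {T : measurableType d} {R : realType}.
Variables (Y : R -> T -> R) (cond : {fset R * R} -> probability T R).
Implicit Types (pi : {fset R * R} -> option R) (H : {fset R * R}).

Fixpoint sampled_history pi H (t : nat) (w : T) : {fset R * R} :=
  if t is n.+1 then
    let Hn := sampled_history pi H n w in
    if pi Hn is Some x then observe Hn x (Y x w) else Hn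
  else H.

Definition stopping_times pi H (w : T) : set nat :=
  [set t | pi (sampled_history pi H t w) = None].

Definition num_samples pi H (w : T) : \bar R :=
  ereal_inf [set t%:R%:E | t in stopping_times pi H w].

(* The value where [num_samples] is infinite is irrelevant: see
   [policy_value]. *)
Definition final_history pi H (w : T) : {fset R * R} :=
  sampled_history pi H
    (xget 0%N [set t : nat | t%:R%:E = num_samples pi H w]) w.

Variables (I : finType) (f : I -> R -> R).

Definition reward (alpha beta : R) H : \bar R :=
  (\int[lebesgue_measure]_(x in `[alpha, beta])
     \big[maxe/-oo]_(i : I) 'E_(cond H)[fun w => f i (Y x w)])%E.

Variable c : R.

Definition policy_value (alpha beta : R) H pi : \bar R :=
  (if 0 < cond H [set w | num_samples pi H w = +oo] then -oo
   else \int[cond H]_w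
          (reward alpha beta (final_history pi H w)
           - c%:E * num_samples pi H w))%E.

Definition value (alpha beta : R) H : \bar R :=
  ereal_sup [set policy_value alpha beta H pi | pi in is_policy].

End Sampling.

(* Main.v *)
Require Import Defs.
From HB Require Import structures.
From mathcomp Require Import all_boot all_order all_algebra finmap.
From mathcomp Require Import all_classical all_reals all_analysis measurable_realfun.
From mathcomp Require Import lra.
Import Order.TTheory GRing.Theory Num.Theory.
Import numFieldNormedType.Exports.

Set Implicit Arguments.
Unset Strict Implicit.
Unset Printing Implicit Defensive.

Local Open Scope classical_set_scope.
Local Open Scope ring_scope.

(* Given the observations at the endpoints of an interval, the Markov property
   makes the process inside the interval independent of the process outside.
   Hence the samples that a policy takes outside an interval act as an external
   randomization of what it does inside: after replacing them by an independent
   copy of the process and fixing the outcome of that copy, one obtains a policy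
   that samples only inside the interval, and by Fubini the gain of the original
   policy on the interval is an average of the values of such policies.  So
   the value on [al, be] is at most the sum of the values on [al, s] and [s, be]
   when s is observed, and each of these is a supremum over policies sampling
   new locations of their own interval.  Conversely, running two such policies
   one after the other realizes, outcome by outcome, the sum of their gains.
   Iterating over the observed locations gives the sum over all gaps. *)

(** A policy sees only the history, so a request for an observed location repeats for ever; a run
    that stops has therefore added one observation per step, and its number of samples is the growth
    of the cardinality of the history. Reward and cost thus become functions of the final history
    alone, and it is enough to compare expectations of functions [F] of histories. This is done step
    by step: each step conditions on one observation and continues from a longer history, so only
    the laws of single variables [Y x] under [cond] have to be localized, never joint laws of paths.
    Two obstacles shape the rest. Histories are finite sets of varying size, so measurability is
    checked on pieces where the history comes from a tuple of fixed length. Expected costs may be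
    infinite, so rewards are shifted by [M * (be - al)] to become nonnegative; Tonelli and monotone
    convergence then apply without integrability, and bounds keep the cost on the larger side
    instead of subtracting it. *)

Section HistoryTheory.
Context {R : realType}.
Implicit Types (H K : {fset R * R}) (x y al be : R).

Lemma locationsP H x :
  reflect (exists y, (x, y) \in H) (x \in locations H).
Proof.
apply: (iffP idP) => [/imfsetP[[u v] /= uvH ->]|[y xyH]]; first by exists v.
by apply/imfsetP; exists (x, y).
Qed.

Lemma locations_mem H p : p \in H -> p.1 \in locations H.
Proof. by case: p => u v uvH; apply/locationsP; exists v. Qed.

Lemma locationsS H K : (K `<=` H)%fset -> {subset locations K <= locations H}.
Proof.
by move=> /fsubsetP KH x /locationsP[y xyK]; apply/locationsP; exists y;
  apply: KH.
Qed.

Lemma is_historyS H K : (K `<=` H)%fset -> is_history H -> is_history K.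
Proof.
move=> /fsubsetP KH [H0 Hfun]; split=> [p /KH /H0//|p q /KH pH /KH qH].
exact: Hfun.
Qed.

Lemma is_history_ge0 H x : is_history H -> x \in locations H -> 0 <= x.
Proof. by move=> [H0 _] /locationsP[y /H0]. Qed.

Lemma observe_visited H x y : x \in locations H -> observe H x y = H.
Proof. by rewrite /observe => ->. Qed.

Lemma observe_fresh H x y : x \notin locations H ->
  observe H x y = ((x, y) |` H)%fset.
Proof. by rewrite /observe => /negbTE ->. Qed.

Lemma observe_sub H x y : (H `<=` observe H x y)%fset.
Proof. by rewrite /observe; case: ifP => // _; rewrite fsubsetUr. Qed.

Lemma observe_location H x y : x \in locations (observe H x y).
Proof.
rewrite /observe; case: ifP => // _.
by apply/locationsP; exists y; rewrite !inE eqxx.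
Qed.

Lemma card_observe_fresh H x y : x \notin locations H ->
  #|` observe H x y| = #|` H|.+1.
Proof.
move=> xH; rewrite observe_fresh// cardfsU1; case: (boolP (_ \in H)) => // xyH.
by move: xH; rewrite (locations_mem xyH).
Qed.

Lemma is_history_observe H x y :
  0 <= x -> is_history H -> is_history (observe H x y).
Proof.
move=> x0 [H0 Hfun]; rewrite /observe; case: (boolP (x \in _)) => // xH.
split=> [p|p q]; rewrite !inE; first by case/orP => [/eqP->//|/H0].
case/orP => [/eqP->|pH]; case/orP => [/eqP->|qH] //=.
- by move=> xq; move: xH; rewrite xq (locations_mem qH).
- by move=> px; move: xH; rewrite -px (locations_mem pH).
- exact: Hfun.
Qed.

Definition restriction al be H : {fset R * R} :=
  [fset p in H | al <= p.1 <= be]%fset.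

Lemma in_restriction al be H p :
  (p \in restriction al be H) = (p \in H) && (al <= p.1 <= be).
Proof. by rewrite !inE. Qed.

Lemma restriction_sub al be H : (restriction al be H `<=` H)%fset.
Proof. by apply/fsubsetP => p; rewrite in_restriction => /andP[]. Qed.

Lemma is_history_restriction al be H :
  is_history H -> is_history (restriction al be H).
Proof. exact: is_historyS (restriction_sub _ _ _). Qed.

Lemma locations_restriction al be H x :
  (x \in locations (restriction al be H)) =
  (x \in locations H) && (al <= x <= be).
Proof.
apply/idP/idP => [/locationsP[y]|/andP[/locationsP[y xyH] xJ]].
  by rewrite in_restriction => /andP[xyH ->]; rewrite (locations_mem xyH).
by apply/locationsP; exists y; rewrite in_restriction xyH.
Qed.

Lemma restriction_observe_out al be H x y : ~~ (al <= x <= be) ->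
  restriction al be (observe H x y) = restriction al be H.
Proof.
move=> xJ; rewrite /observe; case: ifP => // _.
apply/fsetP => p; rewrite !in_restriction !inE.
by case: eqP => //= ->; rewrite (negbTE xJ) andbF.
Qed.

Lemma restriction_observe_in al be H x y : al <= x <= be ->
  restriction al be (observe H x y) = observe (restriction al be H) x y.
Proof.
move=> xJ; rewrite /observe locations_restriction xJ andbT.
case: ifP => // _; apply/fsetP => p; rewrite !(in_restriction, inE).
by case: eqP => //= ->.
Qed.

Lemma restriction_id al be H :
  restriction al be (restriction al be H) = restriction al be H.
Proof. by apply/fsetP => p; rewrite !in_restriction -andbA andbb. Qed.

Lemma in_history_of n (t : n.-tuple (R * R)) p :
  (p \in history_of t) = (p \in tval t).
Proof. by rewrite inE. Qed.

Definition history_lookup K x : R := xget 0 [set y | (x, y) \in K].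

Lemma history_lookupE K x y : is_history K -> (x, y) \in K ->
  history_lookup K x = y.
Proof.
move=> [_ Kfun] xyK; apply: xget_unique => //= z xzK.
exact: (Kfun (x, z) (x, y)).
Qed.

Lemma history_lookup0 K x : x \notin locations K -> history_lookup K x = 0.
Proof.
move=> xK; apply: xgetPN => y /= xyK.
by move: xK; rewrite (locations_mem xyK).
Qed.

End HistoryTheory.

(** * Random histories *)

Section RandomHistory.
Context {R : realType} {d} {S : measurableType d}.
Implicit Types (h : S -> {fset R * R}) (D E : set S).

(* A tuple has a fixed length whereas the number of observations is random,
   so a random history only has to be given by a measurable tuple on each
   piece of a countable measurable cover. *)
Inductive random_history_on h : set S -> Prop :=
| random_history_tuple m (t : S -> m.-tuple (R * R)) D of
    measurable D & measurable_fun [set: S] t &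
    (forall s, histories (t s)) & (forall s, D s -> h s = history_of (t s)) :
    random_history_on h D
| random_history_bigcup (D : nat -> set S) of
    (forall k, random_history_on h (D k)) :
    random_history_on h (\bigcup_k D k).

Definition random_history h := random_history_on h [set: S].

Lemma random_history_onI h D E : measurable E ->
  random_history_on h D -> random_history_on h (D `&` E).
Proof.
move=> mE; elim=> [m t F mF mt th hF|F _ IH].
  apply: (random_history_tuple _ mt) => //; first exact: measurableI.
  by move=> s [Fs _]; exact: hF.
by rewrite setI_bigcupl; exact: random_history_bigcup.
Qed.

Lemma random_history_onU h D E :
  random_history_on h D -> random_history_on h E ->
    random_history_on h (D `|` E).
Proof.
by move=> hD hE; rewrite -bigcup2E; apply: random_history_bigcup => -[|[|k]] //=;
   rewrite -(setI0 D); exact: random_history_onI.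
Qed.

Lemma eq_random_history_on h h' D : (forall s, D s -> h s = h' s) ->
  random_history_on h D -> random_history_on h' D.
Proof.
move=> + hD; elim: hD => [m t F mF mt th hF hh'|F _ IH hh'].
  by apply: (random_history_tuple mF mt) => // s Fs; rewrite -hh'// hF.
by apply: random_history_bigcup => k; apply: IH => s Fs; apply: hh'; exists k.
Qed.

(** Measurability is reduced to tuples of fixed length by induction on the cover. [Q] also sees the
    sample point, so that it can compare the history with a random location. *)
Lemma random_history_pred (Q : S -> {fset R * R} -> Prop) h D :
  (forall m (t : S -> m.-tuple (R * R)), measurable_fun [set: S] t ->
     (forall s, histories (t s)) -> measurable [set s | Q s (history_of (t s))]) ->
  random_history_on h D -> measurable (D `&` [set s | Q s (h s)]).
Proof.
move=> mQ; elim=> [m t F mF mt th hF|F _ IH]; last first.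
  by rewrite setI_bigcupl; exact: bigcupT_measurable.
rewrite (_ : _ `&` _ = F `&` [set s | Q s (history_of (t s))]).
  by apply: measurableI => //; exact: mQ.
by apply/seteqP; split=> s /= [Fs]; rewrite hF.
Qed.

Lemma random_history_predT (Q : S -> {fset R * R} -> Prop) h :
  (forall m (t : S -> m.-tuple (R * R)), measurable_fun [set: S] t ->
     (forall s, histories (t s)) -> measurable [set s | Q s (history_of (t s))]) ->
  random_history h -> measurable [set s | Q s (h s)].
Proof. by move=> mQ hh; rewrite -[X in measurable X]setTI;
  exact: random_history_pred. Qed.

Lemma random_history_is_history h s : random_history h -> is_history (h s).
Proof.
rewrite /random_history => hh; have : [set: S] s by [].
elim: hh => [m t D _ _ th hD /hD ->|D _ IH [k _ Dk]]; first exact: th.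
exact: IH Dk.
Qed.

Lemma random_history_if (E : set S) h1 h2 : measurable E ->
  random_history h1 -> random_history h2 ->
  random_history (fun s => if s \in E then h1 s else h2 s).
Proof.
move=> mE hh1 hh2; rewrite /random_history.
have -> : [set: S] = ([set: S] `&` ~` E) `|` ([set: S] `&` E).
  by rewrite -setIUr setvU setIT.
apply: random_history_onU.
  apply: (@eq_random_history_on h2); last first.
    by apply: random_history_onI; [exact: measurableC|exact: hh2].
  by move=> s [_ /= nE]; rewrite memNset.
apply: (@eq_random_history_on h1); last exact: random_history_onI.
by move=> s [_ /= nE]; rewrite mem_set.
Qed.

End RandomHistory.

(** * Measurability of finite combinations of conditions on coordinates *)

Section MeasurableSets.
Context {d} {S : measurableType d} {R : realType}.

Lemma measurable_exists (I : finType) (A : I -> set S) :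
  (forall i, measurable (A i)) -> measurable [set s | exists i, A i s].
Proof.
move=> mA; rewrite (_ : [set s | _] = \bigcup_i A i).
  by apply: fin_bigcup_measurable => //; exact: finite_finset.
by apply/seteqP; split=> s [i]; exists i.
Qed.

Lemma measurable_forall (I : finType) (A : I -> set S) :
  (forall i, measurable (A i)) -> measurable [set s | forall i, A i s].
Proof.
move=> mA; rewrite (_ : [set s | _] = ~` [set s | exists i, (~` A i) s]).
  by apply: measurableC; apply: measurable_exists => i; exact: measurableC.
apply/seteqP; split=> s /= As; first by case=> i; apply.
by move=> i; apply: contrapT => nAi; apply: As; exists i.
Qed.

Lemma measurable_set_bool (b : S -> bool) :
  measurable_fun [set: S] b -> measurable [set s | b s].
Proof.
move=> /(_ measurableT [set true]); rewrite setTI (_ : _ @^-1` _ = [set s | b s]).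
  exact.
by apply/seteqP; split=> s /=.
Qed.

Lemma measurable_set_eqr (x y : S -> R) : measurable_fun [set: S] x ->
  measurable_fun [set: S] y -> measurable [set s | x s = y s].
Proof.
move=> mx my; rewrite (_ : [set s | _] = [set s | x s == y s]).
  exact/measurable_set_bool/measurable_fun_eqr.
by apply/seteqP; split=> s /= /eqP.
Qed.

Lemma measurable_set_itv (x : S -> R) (al be : R) : measurable_fun [set: S] x ->
  measurable [set s | al <= x s <= be].
Proof.
move=> /(_ measurableT `[al, be]%classic (measurable_itv _)).
by rewrite setTI (_ : _ @^-1` _ = [set s | al <= x s <= be]).
Qed.

Lemma measurable_half_strip : measurable ([set x : R | 0 <= x] `*` [set: S]).
Proof.
apply: measurableX => //; rewrite (_ : [set x | 0 <= x] = `[0, +oo[%classic)//.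
by apply/seteqP; split=> u /=; rewrite in_itv/= andbT.
Qed.

Lemma measurable_fun_mem (D : set S) : measurable D ->
  measurable_fun [set: S] (fun s => s \in D).
Proof.
move=> mD; apply: (@measurable_fun_bool _ _ _ _ true).
rewrite setTI (_ : _ @^-1` _ = D)//.
by apply/seteqP; split=> s /=; [move/set_mem|move=> Ds; rewrite mem_set].
Qed.

Section Tuples.
Context m (t : S -> m.-tuple (R * R)).
Hypothesis mt : measurable_fun [set: S] t.

Lemma measurable_tnth1 (i : 'I_m) : measurable_fun [set: S] (fun s => (tnth (t s) i).1).
Proof.
exact: measurableT_comp measurable_fst ((measurable_fun_tnthP t).1 mt i). Qed.

Lemma measurable_tnth2 i : measurable_fun [set: S] (fun s => (tnth (t s) i).2).
Proof.
exact: measurableT_comp measurable_snd ((measurable_fun_tnthP t).1 mt i). Qed.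

End Tuples.

End MeasurableSets.

(** * Measurable operations on histories *)

Section HistoriesMeasurable.
Context {R : realType}.

(** Validity of a tuple is a finite conjunction of conditions on single entries and on pairs of
    entries. *)
Lemma measurable_histories n : measurable (@histories R n).
Proof.
rewrite (_ : @histories R n =
    [set t : n.-tuple (R * R) | forall i : 'I_n, 0 <= (tnth t i).1] `&`
    [set t | forall ij : 'I_n * 'I_n, (~` [set t : n.-tuple (R * R) |
       (tnth t ij.1).1 = (tnth t ij.2).1] `|`
       [set t | (tnth t ij.1).2 = (tnth t ij.2).2]) t]).
  have m1 i := measurable_tnth1 (@measurable_id _ (n.-tuple (R * R)) setT) i.
  have m2 i := measurable_tnth2 (@measurable_id _ (n.-tuple (R * R)) setT) i.
  apply: measurableI; apply: measurable_forall => i.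
    by apply: measurable_set_bool; apply: measurable_fun_ler.
  apply: measurableU; last by apply: measurable_set_eqr; [exact: m2|exact: m2].
  by apply: measurableC; apply: measurable_set_eqr; [exact: m1|exact: m1].
apply/seteqP; split=> t /=.
  move=> [t0 tfun]; split=> [i|[i j] /=].
    by apply: t0; rewrite in_history_of mem_tnth.
  have [tij|] := pselect ((tnth t i).1 = (tnth t j).1); last by left.
  by right; apply: tfun; rewrite ?in_history_of ?mem_tnth.
move=> [t0 tfun]; split=> [p|p q]; rewrite !in_history_of.
  by move=> /tnthP[i ->].
by move=> /tnthP[i ->] /tnthP[j ->]; case: (tfun (i, j)).
Qed.

Definition history_measurable (F : {fset R * R} -> \bar R) : Prop :=
  forall n, measurable_fun (@histories R n) (fun t => F (history_of t)).

Lemma history_of_nseq0 n :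
  is_history (history_of [tuple of nseq n (0, 0)] : {fset R * R}).
Proof.
split=> [p|p q]; rewrite !in_history_of !mem_nseq => /andP[_ /eqP->]//.
by move=> /andP[_ /eqP->].
Qed.

End HistoriesMeasurable.
Arguments measurable_histories {R} n.

Section RandomHistoryOperations.
Context {R : realType} {d} {S : measurableType d}.
Implicit Types (h : S -> {fset R * R}) (D E : set S).

(** Validity is required on [D] only: off [D] the tuple is replaced by a constant one of the same
    length that is a valid history. *)
Lemma random_history_tupleW h D m (t : S -> m.-tuple (R * R)) :
  measurable D -> measurable_fun [set: S] t ->
  (forall s, D s -> histories (t s) /\ h s = history_of (t s)) ->
  random_history_on h D.
Proof.
move=> mD mt hD.
apply: (@random_history_tuple _ _ _ _ _
  (fun s => if s \in D then t s else [tuple of nseq m (0, 0)])) => //.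
- apply: measurable_fun_ifT => //; exact: measurable_fun_mem.
- by move=> s; case: ifPn => [/set_mem/hD[]//|_]; exact: history_of_nseq0.
- by move=> s Ds; rewrite mem_set//; case: (hD s Ds).
Qed.

Lemma random_history_cst (H : {fset R * R}) : is_history H ->
  random_history (fun _ : S => H).
Proof.
move=> HH; have HE : history_of (in_tuple (enum_fset H)) = H.
  by apply/fsetP => p; rewrite in_history_of.
apply: (@random_history_tupleW _ _ _ (fun=> in_tuple (enum_fset H))) => //.
by move=> s _; rewrite /histories/= HE.
Qed.

Lemma measurable_random_history h F : history_measurable F ->
  random_history h -> measurable_fun [set: S] (fun s => F (h s)).
Proof.
move=> mF hh _ B mB; rewrite setTI.
apply: (@random_history_predT _ _ _ (fun _ K => B (F K))) => // m t mt th.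
have := mt measurableT _ (mF m (measurable_histories m) B mB).
rewrite setTI; congr measurable; apply/seteqP; split=> s /=; first by case.
by split=> //; exact: th.
Qed.

Lemma measurable_policy pi h (B : set (option R)) : is_policy pi ->
  random_history h -> measurable (Some @^-1` B : set R) ->
  measurable [set s | B (pi (h s))].
Proof.
move=> [_ mpi] hh mB.
apply: (@random_history_predT _ _ _ (fun _ K => B (pi K))) => // m t mt th.
have := mt measurableT _ (mpi m B mB).
rewrite setTI; congr measurable; apply/seteqP; split=> s /=; first by case.
by split=> //; exact: th.
Qed.

Lemma measurable_locations (x : S -> R) h : measurable_fun [set: S] x ->
  random_history h -> measurable [set s | x s \in locations (h s)].
Proof.
move=> mx; apply: (@random_history_predT _ _ _ (fun s K => x s \in locations K)).
move=> m t mt _.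
rewrite (_ : [set s | _] = [set s | exists i, x s = (tnth (t s) i).1]).
  apply: measurable_exists => i; apply: measurable_set_eqr => //.
  exact: measurable_tnth1.
apply/seteqP; split=> s /=.
  by move=> /locationsP[y]; rewrite in_history_of => /tnthP[i xyE]; exists i;
    rewrite -xyE.
by move=> [i ->]; apply: locations_mem; rewrite in_history_of mem_tnth.
Qed.

Lemma measurable_history_lookup (x : S -> R) h : measurable_fun [set: S] x ->
  random_history h -> measurable_fun [set: S] (fun s => history_lookup (h s) (x s)).
Proof.
move=> mx hh _ B mB; rewrite setTI.
apply: (@random_history_predT _ _ _ (fun s K => B (history_lookup K (x s)))) => //.
move=> m t mt th; pose A i := [set s | x s = (tnth (t s) i).1].
have mA i : measurable (A i).
  by apply: measurable_set_eqr => //; exact: measurable_tnth1.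
rewrite (_ : [set s | _] =
    [set s | exists i, (A i `&` [set s | B (tnth (t s) i).2]) s] `|`
    ([set s | forall i, (~` A i) s] `&` [set s | B 0])).
  apply: measurableU.
    apply: measurable_exists => i; apply: measurableI => //.
    by have := measurable_tnth2 mt i measurableT mB; rewrite setTI.
  apply: measurableI; first by apply: measurable_forall => i;
    exact: measurableC.
  have [B0|nB0] := pselect (B 0).
    by rewrite (_ : [set _ | _] = setT)//; apply/seteqP; split.
  by rewrite (_ : [set _ | _] = set0)//; apply/seteqP; split.
have lookupE s i : A i s -> history_lookup (history_of (t s)) (x s) = (tnth (t s) i).2.
  rewrite /A/= => ->; apply: history_lookupE; first exact: th.
  by rewrite in_history_of -surjective_pairing mem_tnth.
apply/seteqP; split=> s /=.
  have [[i Ai]|nA] := pselect (exists i, A i s).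
    by rewrite (lookupE s i)// => Bi; left; exists i.
  rewrite history_lookup0 => [B0|].
    by right; split=> // i Ai; apply: nA; exists i.
  apply/negP => /locationsP[y]; rewrite in_history_of => /tnthP[i xyE].
  by apply: nA; exists i; rewrite /A/= -xyE.
move=> [[i [Ai Bi]]|[nA B0]]; first by rewrite (lookupE s i).
rewrite history_lookup0//.
apply/negP => /locationsP[y]; rewrite in_history_of => /tnthP[i xyE].
by apply: (nA i); rewrite /A/= -xyE.
Qed.

(** A tuple may list an observation twice, so its length is not the cardinality: going down the
    tuple, the head counts only if it does not recur in the tail. *)
Lemma measurable_history_card h : random_history h ->
  measurable_fun [set: S] (fun s => #|` h s|%:R : R).
Proof.
move=> hh _ B mB; rewrite setTI.
apply: (@random_history_predT _ _ _ (fun s K => B (#|` K|%:R : R))) => // m t mt _.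
suff /(_ measurableT _ mB) : measurable_fun [set: S] (fun s => #|` history_of (t s)|%:R : R).
  by rewrite setTI.
elim: m t mt => [|m IH] t mt.
  rewrite (_ : (fun _ => _) = fun=> 0)//; apply/funext => s.
  rewrite (_ : history_of (t s) = fset0) ?cardfs0//.
  by apply/fsetP => p; rewrite in_history_of tuple0.
pose u s : m.-tuple (R * R) := [tuple of behead (t s)].
have mu : measurable_fun [set: S] u.
  exact: (measurableT_comp (@measurable_behead _ _ m) mt).
pose A := [set s | exists i, ([set s | (thead (t s)).1 = (tnth (u s) i).1] `&`
  [set s | (thead (t s)).2 = (tnth (u s) i).2]) s].
have mA : measurable A.
  apply: measurable_exists => i; apply: measurableI; apply: measurable_set_eqr;
    by [exact: measurable_tnth1|exact: measurable_tnth2].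
rewrite (_ : (fun _ => _) =
    fun s => (if s \in A then 0 else 1) + #|` history_of (u s)|%:R).
  apply: measurable_funD; last exact: IH.
  by apply: measurable_fun_ifT => //; exact: measurable_fun_mem.
apply/funext => s.
have -> : history_of (t s) = (thead (t s) |` history_of (u s))%fset.
  apply/fsetP => p; rewrite inE /= !inE [in LHS](tuple_eta (t s)) inE.
  by congr (_ || _); rewrite inE.
rewrite cardfsU1 natrD; congr (_ + _).
rewrite in_history_of; case: ifPn => [/set_mem[i [/= t1 t2]]|/negP nA].
  rewrite [thead _]surjective_pairing t1 t2 -surjective_pairing.
  by rewrite mem_tnth.
case: (boolP (_ \in _)) => // /tnthP[i tE]; exfalso; apply: nA; apply: mem_set.
by exists i; rewrite /= tE.
Qed.

(** A new location lengthens the tuple and a visited one does not; this is why the length may differ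
    between the pieces of the cover. *)
Lemma random_history_observe (x y : S -> R) h : measurable_fun [set: S] x ->
  measurable_fun [set: S] y -> (forall s, 0 <= x s) -> random_history h ->
  random_history (fun s => observe (h s) (x s) (y s)).
Proof.
rewrite /random_history => mx my x0; elim=> [m t D mD mt th hD|D _ IH];
  last first.
  exact: random_history_bigcup.
pose E := [set s | x s \in locations (history_of (t s))].
have mE : measurable E.
  apply: measurable_locations => //; exact: (random_history_tuple measurableT mt).
have -> : D = (D `&` ~` E) `|` (D `&` E) by rewrite -setIUr setvU setIT.
apply: random_history_onU.
  apply: (@random_history_tupleW _ _ _ (fun s => [tuple of (x s, y s) :: t s])).
  - by apply: measurableI => //; exact: measurableC.
  - by apply: measurable_cons => //; exact: measurable_fun_pair.
  move=> s [Ds /negP nE]; rewrite hD//.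
  have oE : observe (history_of (t s)) (x s) (y s) =
            history_of [tuple of (x s, y s) :: t s].
    rewrite observe_fresh//; apply/fsetP => p.
    by rewrite !inE.
  by split=> //; rewrite /histories/= -oE; apply: is_history_observe => //;
    exact: th.
apply: (random_history_tuple _ mt) => //; first exact: measurableI.
by move=> s [Ds Es]; rewrite hD// observe_visited.
Qed.

(** The number of surviving entries varies, so entries are not removed: those outside the interval
    are overwritten by a chosen entry inside, which yields the restriction as underlying set. *)
Lemma random_history_restriction (al be : R) h : random_history h ->
  random_history (fun s => restriction al be (h s)).
Proof.
rewrite /random_history; elim=> [m t D mD mt th hD|D _ IH]; last first.
  exact: random_history_bigcup.
pose A i := [set s | al <= (tnth (t s) i).1 <= be].
have mA i : measurable (A i) by apply: measurable_set_itv;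
  exact: measurable_tnth1.
(* For [k < m] this is the piece where entry [k] can serve as the filler; every other [k] gives the
   piece where no entry lies inside. *)
pose B k := if insub k is Some i then A i else [set s | forall i, (~` A i) s].
have DE : D = \bigcup_k (D `&` B k).
  apply/seteqP; split=> s; last by case=> k _ [].
  move=> Ds; have [[i Ai]|nA] := pselect (exists i, A i s).
    by exists (val i) => //; split=> //; rewrite /B valK.
  exists m => //; split=> //; rewrite /B; case: insubP => [i _ im|_ i Ai].
    by move: (ltn_ord i); rewrite im ltnn.
  by apply: nA; exists i.
rewrite DE; apply: random_history_bigcup => k.
rewrite /B; case: insubP => [i _ _|_].
  pose u s := [tuple (if al <= (tnth (t s) j).1 <= be then tnth (t s) j
                      else tnth (t s) i) | j < m].
  apply: (@random_history_tupleW _ _ _ u).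
  - exact: measurableI.
  - apply/measurable_fun_tnthP => j; rewrite /u.
    rewrite (_ : _ \o _ = fun s => if s \in A j then tnth (t s) j else tnth (t s) i).
      by apply: measurable_fun_ifT; [exact: measurable_fun_mem|
        exact: (measurable_fun_tnthP t).1 mt _..].
    apply/funext => s; rewrite /= tnth_mktuple.
    case: ifPn => [jJ|jJ]; first by rewrite mem_set.
    by rewrite memNset//; exact/negP.
  move=> s [Ds Ai].
  have rE : restriction al be (h s) = history_of (u s).
    apply/fsetP => p; rewrite in_restriction hD// !in_history_of.
    apply/idP/idP => [/andP[/tnthP[j pE] pJ]|/tnthP[j ->]].
      by apply/tnthP; exists j; rewrite tnth_mktuple -pE pJ.
    by rewrite tnth_mktuple; case: ifPn => [->|_]; rewrite ?andbT mem_tnth.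
  split=> //; rewrite /histories/= -rE; apply: is_history_restriction.
  by rewrite hD//; exact: th.
apply: (@random_history_tupleW _ _ _ (fun=> [tuple] : 0.-tuple (R * R))).
- by apply: measurableI => //; apply: measurable_forall => i;
  exact: measurableC.
- exact: measurable_cst.
move=> s [Ds nA].
have rE : restriction al be (h s) = history_of ([tuple] : 0.-tuple (R * R)).
  apply/fsetP => p; rewrite in_restriction hD// !in_history_of.
  by apply/negP => /andP[/tnthP[j ->]]; exact: nA.
split=> //; rewrite /histories/= -rE; apply: is_history_restriction.
by rewrite hD//; exact: th.
Qed.

End RandomHistoryOperations.

Lemma random_history_comp {R : realType} d d' (S : measurableType d)
    (S' : measurableType d') (phi : S' -> S) (h : S -> {fset R * R}) :
  measurable_fun [set: S'] phi -> random_history h ->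
  random_history (fun s => h (phi s)).
Proof.
rewrite /random_history => mphi hh; rewrite -(preimage_setT phi).
elim: hh => [m t D mD mt th hD|D _ IH]; last first.
  by rewrite preimage_bigcup; exact: random_history_bigcup.
apply: (@random_history_tuple _ _ _ _ _ (t \o phi)).
- by rewrite -[X in measurable X]setTI; exact: mphi.
- exact: measurableT_comp.
- by move=> s; exact: th.
- by move=> s /hD.
Qed.

Section ObservedHistory.
Context {R : realType}.

(** Invalid tuples are sent to the empty history, so that measurability can be proved on the whole
    space of tuples instead of on [histories]. *)
Definition observed_history n (t : n.-tuple (R * R)) : {fset R * R} :=
  if t \in @histories R n then history_of t else fset0.

Lemma is_history0 : is_history (fset0 : {fset R * R}).
Proof. by split=> [p|p q]; rewrite inE. Qed.

Lemma random_observed_history n : random_history (@observed_history n).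
Proof.
rewrite /random_history; have -> : [set: n.-tuple (R * R)] =
    ~` @histories R n `|` @histories R n by rewrite setvU.
apply: random_history_onU.
  apply: (@eq_random_history_on _ _ _ (fun=> fset0)).
    by move=> t /= nt; rewrite /observed_history memNset.
  rewrite -(setTI (~` _)); apply: random_history_onI.
    by apply: measurableC; exact: measurable_histories.
  by apply: random_history_cst; exact: is_history0.
apply: (@random_history_tupleW _ _ _ _ _ _ id);
  first exact: measurable_histories.
  exact: measurable_id.
by move=> t th; split=> //; rewrite /observed_history mem_set.
Qed.

Lemma history_measurableI (F : {fset R * R} -> \bar R) :
  (forall n, measurable_fun [set: n.-tuple (R * R)]
     (fun t => F (observed_history t))) -> history_measurable F.
Proof.
move=> mF n; apply: eq_measurable_fun (measurable_funTS (mF n)) => t th.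
by rewrite /observed_history th.
Qed.

Lemma is_policyI (pi : {fset R * R} -> option R) :
  (forall H x, is_history H -> pi H = Some x -> 0 <= x) ->
  (forall n (B : set (option R)), measurable (Some @^-1` B : set R) ->
     measurable [set t : n.-tuple (R * R) | B (pi (observed_history t))]) ->
  is_policy pi.
Proof.
move=> pi0 mpi; split=> // n B mB.
have := measurableI _ _ (measurable_histories n) (mpi n B mB).
congr measurable; apply/seteqP; split=> t /= [th];
  by rewrite /observed_history mem_set.
Qed.

End ObservedHistory.

(** * Runs of policies *)

Section Runs.
Context {d} {T : measurableType d} {R : realType}.
Variable Y : R -> T -> R.
Implicit Types (pi sigma : {fset R * R} -> option R) (H G K : {fset R * R}) (w : T).

Definition next_history pi H w : {fset R * R} :=
  if pi H is Some x then observe H x (Y x w) else H.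

(** The definition adds the last step; conditioning on the first observation needs the first step
    split off instead. *)
Lemma sampled_historySr pi H n w :
  sampled_history Y pi H n.+1 w = sampled_history Y pi (next_history pi H w) n w.
Proof.
elim: n => [//|n IH].
by rewrite -[RHS]/(next_history pi (sampled_history Y pi _ n w) w) -IH.
Qed.

Lemma sampled_history_stop pi H m n w : (m <= n)%N ->
  pi (sampled_history Y pi H m w) = None ->
  sampled_history Y pi H n w = sampled_history Y pi H m w.
Proof.
move=> mn pim; rewrite -(subnKC mn); elim: (n - m)%N => [|k IH].
  by rewrite addn0.
by rewrite addnS /= IH pim.
Qed.

Lemma sampled_history_sub pi H m n w : (m <= n)%N ->
  (sampled_history Y pi H m w `<=` sampled_history Y pi H n w)%fset.
Proof.
move=> mn; rewrite -(subnKC mn); elim: (n - m)%N => [|k IH].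
  by rewrite addn0.
rewrite addnS /=; apply: fsubset_trans IH _.
by case: (pi _) => // x; exact: observe_sub.
Qed.

Lemma is_history_sampled pi H n w : is_policy pi -> is_history H ->
  is_history (sampled_history Y pi H n w).
Proof.
move=> ppi HH; elim: n => [//|n IH] /=.
case E: (pi _) => [x|//]; apply: is_history_observe => //.
exact: policy_ge0 E.
Qed.

Lemma card_sampled_history pi H n w :
  (#|` sampled_history Y pi H n w| <= #|` H| + n)%N.
Proof.
elim: n => [|n IH] /=; first by rewrite addn0.
rewrite addnS; case: (pi _) => [x|]; last exact: leq_trans IH _.
have [xH|xH] := boolP (x \in locations (sampled_history Y pi H n w)).
  by rewrite observe_visited//; exact: leq_trans IH _.
by rewrite card_observe_fresh.
Qed.

Lemma random_sampled_history pi (h : T -> {fset R * R}) n :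
  measurable_process Y -> is_policy pi -> random_history h ->
  random_history (fun w => sampled_history Y pi (h w) n w).
Proof.
move=> mY ppi hh; elim: n => [//|n IH].
pose g w := sampled_history Y pi (h w) n w.
(* Where the policy stops, the location 0 stands in; the case distinction on [E] below discards
   it. *)
pose x w := odflt 0 (pi (g w)).
have mx : measurable_fun [set: T] x.
  move=> _ B mB; rewrite setTI.
  exact: (@measurable_policy _ _ _ pi g [set o | B (odflt 0 o)]).
have x0 w : 0 <= x w.
  rewrite /x; case E: (pi _) => [z|//] /=; apply: policy_ge0 E => //.
  exact: random_history_is_history.
have my : measurable_fun [set: T] (fun w => Y (x w) w).
  apply: (@measurable_comp _ _ _ _ _ _ ([set x : R | 0 <= x] `*` [set: T])
    (fun p : R * T => Y p.1 p.2) _ (fun w => (x w, w))) => //.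
  - exact: measurable_half_strip.
  - by move=> _ [w _ <-] /=; split=> //; exact: x0.
  - exact: measurable_fun_pair.
pose E := [set w | pi (g w) <> None].
have mE : measurable E.
  apply: (@measurable_policy _ _ _ pi g [set o | o <> None]) => //.
  by rewrite (_ : _ @^-1` _ = setT)//; apply/seteqP; split.
apply: (@eq_random_history_on _ _ _
  (fun w => if w \in E then observe (g w) (x w) (Y (x w) w) else g w));
    last first.
  by apply: random_history_if => //; exact: random_history_observe.
move=> w _; rewrite /= -/(g w) /x; case: ifPn => [/set_mem|/negP nE].
  by rewrite /E/=; case: (pi _).
by case E': (pi _) => [z|//]; exfalso; apply: nE; apply: mem_set;
  rewrite /E/= E'.
Qed.

Lemma num_samplesE pi H n w : pi (sampled_history Y pi H n w) = None ->
  (forall m, (m < n)%N -> pi (sampled_history Y pi H m w) <> None) ->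
  num_samples Y pi H w = n%:R%:E /\
  final_history Y pi H w = sampled_history Y pi H n w.
Proof.
move=> pin pim.
have nsE : num_samples Y pi H w = n%:R%:E.
  apply/eqP; rewrite eq_le; apply/andP; split.
    by apply: ereal_inf_lbound; exists n.
  apply: le_ereal_inf_tmp => _ [m pm <-]; rewrite lee_fin ler_nat leqNgt.
  by apply/negP => /pim; apply.
split=> //; rewrite /final_history; congr sampled_history.
apply: xget_unique; first by rewrite /= nsE.
by move=> m /=; rewrite nsE => -[/eqP]; rewrite eqr_nat => /eqP.
Qed.

Lemma num_samples_pinfty pi H w :
  num_samples Y pi H w = +oo%E <->
  (forall n, pi (sampled_history Y pi H n w) <> None).
Proof.
split=> [nsy n pin|npi].
  have : (num_samples Y pi H w <= n%:R%:E)%E by apply: ereal_inf_lbound;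
    exists n.
  by rewrite nsy leye_eq.
rewrite /num_samples (_ : stopping_times _ _ _ _ = set0) ?image_set0 ?ereal_inf0//.
by apply/seteqP; split=> n //= /npi.
Qed.

(* [K] is the run of [sigma] slowed down by steps that leave it unchanged. *)
Section TimeChange.
Variables (sigma : {fset R * R} -> option R) (G : {fset R * R}) (w : T).
Variable K : nat -> {fset R * R}.
Hypothesis K0 : K 0%N = G.
Hypothesis KS : forall n, K n.+1 = K n \/
  exists x, [/\ sigma (K n) = Some x, x \notin locations (K n) &
                K n.+1 = observe (K n) x (Y x w)].

(** Every step that moves [K] adds one location, so the cardinality tells how many steps of the true
    run have been made. *)
Lemma time_change n :
  exists2 j, K n = sampled_history Y sigma G j w & #|` K n| = (#|` G| + j)%N.
Proof.
elim: n => [|n [j Kj cj]]; first by exists 0%N; rewrite ?addn0 ?K0.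
case: (KS n) => [->|[x [sx xK ->]]]; first by exists j.
by exists j.+1; [rewrite /= -Kj sx|rewrite card_observe_fresh// cj addnS].
Qed.

Lemma time_change_stop N : sigma (K N) = None ->
  [/\ final_history Y sigma G w = K N, (#|` G| <= #|` K N|)%N &
      num_samples Y sigma G w = (#|` K N|%:R - #|` G|%:R)%:E].
Proof.
move=> sN; have [j Kj cj] := time_change N.
have [|m mj sm|ns fin] := @num_samplesE sigma G j w.
- by rewrite -Kj.
(* If [sigma] stopped at some [m < j], its run would be frozen there with at most [m] new
   observations, fewer than the [j] that [K N] has. *)
- have := sampled_history_stop (ltnW mj) sm; rewrite -Kj => KE.
  by have := card_sampled_history sigma G m w;
    rewrite -KE cj leq_add2l leqNgt mj.
- split; first by rewrite fin.
    by rewrite cj leq_addr.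
  by rewrite ns cj natrD addrAC subrr add0r.
Qed.

End TimeChange.

(** The run itself serves as [K], a request for a visited location counting as an idle step. The
    number of samples thereby becomes a function of the final history. *)
Lemma final_historyE pi H N w : pi (sampled_history Y pi H N w) = None ->
  [/\ final_history Y pi H w = sampled_history Y pi H N w,
      (#|` H| <= #|` sampled_history Y pi H N w|)%N &
      num_samples Y pi H w = (#|` sampled_history Y pi H N w|%:R - #|` H|%:R)%:E].
Proof.
apply: (@time_change_stop pi H w (fun n => sampled_history Y pi H n w)) => // n /=.
case E: (pi _) => [x|]; last by left.
have [xK|xK] := boolP (x \in locations (sampled_history Y pi H n w)).
  by left; rewrite observe_visited.
by right; exists x.
Qed.

End Runs.

(** * Policies confined to an interval, and their combination *)

Section InsidePolicies.
Context {R : realType}.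
Implicit Types (pi sigma : {fset R * R} -> option R) (H G K : {fset R * R}).
Implicit Types (al s be : R).

(** Only new locations may be requested, so no step is idle, and an observed endpoint shared with a
    neighbouring interval is requested on neither side. *)
Definition inside_policy al be sigma : Prop :=
  is_policy sigma /\
  (forall K x, sigma K = Some x -> al <= x <= be /\ x \notin locations K).

(** No memory of the phase is needed: for inside policies with [s] observed, the samples of [sigma2]
    do not change the history that [sigma1] sees, so once [sigma1] stops it keeps stopping. *)
Definition combined_policy al s be sigma1 sigma2 K : option R :=
  if sigma1 (restriction al s K) is Some x then Some x
  else sigma2 (restriction s be K).

Lemma combined_policyP al s be sigma1 sigma2 :
  is_policy sigma1 -> is_policy sigma2 ->
  is_policy (combined_policy al s be sigma1 sigma2).
Proof.
move=> p1 p2; apply: is_policyI => [H x HH|n B mB].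
  rewrite /combined_policy; case E: (sigma1 _) => [z|].
    by move=> [<-]; exact: (policy_ge0 p1 (is_history_restriction _ _ HH) E).
  by move=> E2; exact: (policy_ge0 p2 (is_history_restriction _ _ HH) E2).
pose h1 (t : n.-tuple (R * R)) := restriction al s (observed_history t).
pose h2 (t : n.-tuple (R * R)) := restriction s be (observed_history t).
have rh1 : random_history h1.
  by apply: random_history_restriction; exact: random_observed_history.
have rh2 : random_history h2.
  by apply: random_history_restriction; exact: random_observed_history.
(* The value [None] of [sigma1] hands over to [sigma2] and is not a decision to stop, hence it is
   removed from [B] in the first set. *)
rewrite (_ : [set t | _] = [set t | (B `\ None) (sigma1 (h1 t))] `|`
   ([set t | [set None] (sigma1 (h1 t))] `&` [set t | B (sigma2 (h2 t))])).
  apply: measurableU; last apply: measurableI.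
  - apply: (@measurable_policy _ _ _ sigma1 h1) => //.
    rewrite (_ : _ @^-1` _ = Some @^-1` B)//.
    by apply/seteqP; split=> x /=; [case|split].
  - apply: (@measurable_policy _ _ _ sigma1 h1) => //.
    by rewrite (_ : _ @^-1` _ = set0)//; apply/seteqP; split.
  - exact: (measurable_policy p2 rh2 mB).
apply/seteqP; split=> t /=; rewrite /combined_policy -/(h1 t) -/(h2 t).
  by case: (sigma1 _) => [x|] Bx; [left|right].
by case: (sigma1 _) => [x|] [[]|[]].
Qed.

Section Combined.
Context {d} {T : measurableType d}.
Variables (Y : R -> T -> R) (al s be : R).
Variables (sigma1 sigma2 : {fset R * R} -> option R) (H : {fset R * R}) (w : T).
Hypothesis sH : s \in locations H.
Hypothesis (in1 : inside_policy al s sigma1) (in2 : inside_policy s be sigma2).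

Let pi := combined_policy al s be sigma1 sigma2.
Let h n := sampled_history Y pi H n w.
Let K1 n := restriction al s (h n).
Let K2 n := restriction s be (h n).

Let sh n : s \in locations (h n).
Proof. by apply: locationsS sH; exact: (@sampled_history_sub _ _ _ Y pi H 0 n w). Qed.

(** A new location in the first interval differs from [s], which is observed, so it lies outside the
    second interval. *)
Let step1 n x : sigma1 (K1 n) = Some x ->
  [/\ x \notin locations (h n), h n.+1 = observe (h n) x (Y x w),
      x \notin locations (K1 n), K1 n.+1 = observe (K1 n) x (Y x w) & K2 n.+1 = K2 n].
Proof.
move=> sx; have [xJ xK] := in1.2 _ _ sx.
have xh : x \notin locations (h n).
  by apply: contra xK => xh; rewrite locations_restriction xh.
have hS : h n.+1 = observe (h n) x (Y x w).
  by rewrite /h /= -/(h n) /pi /combined_policy -/(K1 n) sx.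
split=> //; first by rewrite /K1 hS restriction_observe_in.
rewrite /K2 hS restriction_observe_out//; apply/negP => /andP[sx' _].
move: xh; rewrite (_ : x = s) ?sh//.
by apply/eqP; rewrite eq_le sx' andbT; case/andP: xJ.
Qed.

Let step2 n x : sigma1 (K1 n) = None -> sigma2 (K2 n) = Some x ->
  [/\ x \notin locations (h n), h n.+1 = observe (h n) x (Y x w),
      x \notin locations (K2 n), K2 n.+1 = observe (K2 n) x (Y x w) & K1 n.+1 = K1 n].
Proof.
move=> s1 sx; have [xJ xK] := in2.2 _ _ sx.
have xh : x \notin locations (h n).
  by apply: contra xK => xh; rewrite locations_restriction xh.
have hS : h n.+1 = observe (h n) x (Y x w).
  by rewrite /h /= -/(h n) /pi /combined_policy -/(K1 n) s1 -/(K2 n) sx.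
split=> //; first by rewrite /K2 hS restriction_observe_in.
rewrite /K1 hS restriction_observe_out//; apply/negP => /andP[_ xs'].
move: xh; rewrite (_ : x = s) ?sh//.
by apply/eqP; rewrite eq_le xs' /=; case/andP: xJ.
Qed.

Let stepN n : sigma1 (K1 n) = None -> sigma2 (K2 n) = None -> h n.+1 = h n.
Proof.
by move=> s1 s2; rewrite /h /= -/(h n) /pi /combined_policy -/(K1 n) s1 -/(K2 n) s2.
Qed.

Let KS1 n : K1 n.+1 = K1 n \/ exists x, [/\ sigma1 (K1 n) = Some x,
  x \notin locations (K1 n) & K1 n.+1 = observe (K1 n) x (Y x w)].
Proof.
case E1: (sigma1 (K1 n)) => [x|]; first by right; exists x; have [] := step1 E1.
left; case E2: (sigma2 (K2 n)) => [x|]; first by have [] := step2 E1 E2.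
by rewrite {1}/K1 stepN.
Qed.

Let KS2 n : K2 n.+1 = K2 n \/ exists x, [/\ sigma2 (K2 n) = Some x,
  x \notin locations (K2 n) & K2 n.+1 = observe (K2 n) x (Y x w)].
Proof.
case E1: (sigma1 (K1 n)) => [x|]; first by left; have [] := step1 E1.
case E2: (sigma2 (K2 n)) => [x|]; first by right; exists x;
  have [] := step2 E1 E2.
by left; rewrite {1}/K2 stepN.
Qed.

Let card_step n : pi (h n) <> None ->
  (#|` K1 n.+1| + #|` K2 n.+1| = (#|` K1 n| + #|` K2 n|).+1)%N /\
  #|` h n.+1| = #|` h n|.+1.
Proof.
rewrite /pi /combined_policy -/(K1 n) -/(K2 n).
case E1: (sigma1 (K1 n)) => [x|].
  have [xh -> xK -> ->] := step1 E1.
  by rewrite !card_observe_fresh// addSn.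
case E2: (sigma2 (K2 n)) => [x|//].
have [xh -> xK -> ->] := step2 E1 E2.
by rewrite !card_observe_fresh// addnS.
Qed.

Lemma combined_policy_final N1 N2 :
  sigma1 (sampled_history Y sigma1 (restriction al s H) N1 w) = None ->
  sigma2 (sampled_history Y sigma2 (restriction s be H) N2 w) = None ->
  exists2 n, pi (h n) = None &
  [/\ final_history Y sigma1 (restriction al s H) w = restriction al s (h n),
      final_history Y sigma2 (restriction s be H) w = restriction s be (h n),
      final_history Y pi H w = h n &
      num_samples Y pi H w =
        (num_samples Y sigma1 (restriction al s H) w +
         num_samples Y sigma2 (restriction s be H) w)%E].
Proof.
move=> s1 s2.
(* Termination: every step that does not stop adds one observation to one of the two restrictions,
   whereas the runs of [sigma1] and [sigma2], which stop by [N1] and [N2], bound how far these can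
   grow. *)
have bound (sigma : {fset R * R} -> option R) G N j :
    sigma (sampled_history Y sigma G N w) = None ->
    (#|` sampled_history Y sigma G j w| <= #|` G| + N)%N.
  move=> sN; have [Nj|/ltnW jN] := leqP N j.
    by rewrite (sampled_history_stop Nj sN); exact: card_sampled_history.
  by apply: leq_trans (card_sampled_history _ _ _ _ _) _; rewrite leq_add2l.
have cards n : (forall m, (m < n)%N -> pi (h m) <> None) ->
    (#|` K1 n| + #|` K2 n| = #|` K1 0| + #|` K2 0| + n)%N /\
    #|` h n| = (#|` H| + n)%N.
  elim: n => [|n IH] nst; first by rewrite !addn0.
  have [c1 c2] := card_step (nst n (ltnSn n)).
  have [|i1 i2] := IH; first by move=> m mn; apply: nst; rewrite ltnS ltnW.
  by rewrite c1 c2 i1 i2 !addnS.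
have [ex|nex] := pselect (exists n, pi (h n) == None); last first.
  have [|c _] := cards (N1 + N2).+1.
    by move=> m _ pm; apply: nex; exists m; apply/eqP.
  have [j1 k1 _] := time_change (K := K1) (erefl _) KS1 (N1 + N2).+1.
  have [j2 k2 _] := time_change (K := K2) (erefl _) KS2 (N1 + N2).+1.
  have := leq_add (bound _ _ _ j1 s1) (bound _ _ _ j2 s2).
  by rewrite -k1 -k2 c addnACA leq_add2l ltnn.
case: (ex_minnP ex) => n /eqP pin nmin.
have nst m : (m < n)%N -> pi (h m) <> None.
  by move=> mn /eqP /nmin; rewrite leqNgt mn.
exists n => //.
have [t1 t2] : sigma1 (K1 n) = None /\ sigma2 (K2 n) = None.
  move: pin; rewrite /pi /combined_policy -/(K1 n) -/(K2 n).
  by case: (sigma1 _).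
have [f1 _ n1] := time_change_stop (K := K1) (erefl _) KS1 t1.
have [f2 _ n2] := time_change_stop (K := K2) (erefl _) KS2 t2.
have [f3 _ n3] := final_historyE pin.
split=> //; rewrite n3 n1 n2 -EFinD; congr EFin.
have [c ch] := cards n nst.
rewrite -/(h n) ch natrD addrAC subrr add0r addrACA -opprD -!natrD c natrD.
by rewrite addrAC subrr add0r.
Qed.

End Combined.

End InsidePolicies.

(** * Simulating the observations outside an interval *)

Section Simulation.
Context {d} {T : measurableType d} {R : realType}.
Variables (Y : R -> T -> R) (al be : R).
Implicit Types (pi : {fset R * R} -> option R) (H K : {fset R * R}) (w : T).

Definition spliced_process x (w : T * T) : R :=
  if al <= x <= be then Y x w.1 else Y x w.2.

(** Inside the interval a location missing from [K] reads 0; [simulated_policy] halts before such a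
    value can influence it. *)
Definition simulated_observation K x w : R :=
  if al <= x <= be then history_lookup K x else Y x w.

Definition simulation pi H w' K n : {fset R * R} :=
  sampled_history (simulated_observation K) pi H n w'.

Definition simulation_halts K (o : option R) : bool :=
  if o is Some x then (al <= x <= be) && (x \notin locations K) else true.

(* Replays [pi] from [H], reading the observations in [al, be] off [K] and
   those outside off the fixed outcome [w'], until [pi] stops or asks for a
   location in [al, be] that [K] does not contain. *)
Definition simulated_policy pi H w' K : option R :=
  xget None [set o | exists n, [/\ o = pi (simulation pi H w' K n),
    simulation_halts K o &
    forall m, (m < n)%N -> ~~ simulation_halts K (pi (simulation pi H w' K m))]].

Lemma simulated_policyE pi H w' K n :
  simulation_halts K (pi (simulation pi H w' K n)) ->
  (forall m, (m < n)%N -> ~~ simulation_halts K (pi (simulation pi H w' K m))) ->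
  simulated_policy pi H w' K = pi (simulation pi H w' K n).
Proof.
move=> hn nh; apply: xget_unique; first by exists n.
move=> _ [m [-> hm nhm]].
have [mn|nm|->//] := ltngtP m n; first by move: (nh _ mn); rewrite hm.
by move: (nhm _ nm); rewrite hn.
Qed.

Lemma simulated_policyN pi H w' K :
  (forall n, ~~ simulation_halts K (pi (simulation pi H w' K n))) ->
  simulated_policy pi H w' K = None.
Proof.
move=> nh; apply: xgetPN => _ [n [-> hn _]].
by move: (nh n); rewrite hn.
Qed.

Section Replay.
Variables (pi : {fset R * R} -> option R) (H : {fset R * R}) (w w' : T).
Hypotheses (ppi : is_policy pi) (HH : is_history H).

Let h n := sampled_history spliced_process pi H n (w, w').
Let K n := restriction al be (h n).

(** [K N] contains every value that the first [N] steps observed inside the interval, and the lookup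
    is unambiguous because [K N] is functional. *)
Lemma simulation_replay N n : (n <= N)%N -> simulation pi H w' (K N) n = h n.
Proof.
elim: n => [//|n IH] nN; rewrite /simulation /= -/(simulation _ _ _ _ _).
rewrite IH ?(ltnW nN)// /h /= -/(h n); case E: (pi (h n)) => [x|//].
have [xh|xh] := boolP (x \in locations (h n));
  first by rewrite !observe_visited.
rewrite /simulated_observation /spliced_process; case: ifP => // xJ /=.
congr observe; apply: history_lookupE.
  by apply: is_history_restriction; exact: is_history_sampled.
rewrite in_restriction xJ andbT.
apply: (fsubsetP (sampled_history_sub spliced_process pi H (w, w') nN)).
by rewrite /= -/(h n) E observe_fresh// /spliced_process xJ !inE eqxx.
Qed.

(** The replay cannot halt at some [n < N] on a missing location: the run observes that location by
    step [n.+1], so it belongs to [K N]. If it halts at [n] because [pi] stops, the run is frozen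
    from there on. *)
Lemma simulated_policy_replay N : simulation_halts (K N) (pi (h N)) ->
  simulated_policy pi H w' (K N) = pi (h N).
Proof.
move=> hN.
have ex : exists n, simulation_halts (K N) (pi (simulation pi H w' (K N) n)).
  by exists N; rewrite simulation_replay.
case: (ex_minnP ex) => n hn nmin.
have nN : (n <= N)%N by apply: nmin; rewrite simulation_replay.
rewrite (@simulated_policyE _ _ _ _ n) => // [|m mn]; last first.
  by apply/negP => /nmin; rewrite leqNgt mn.
move: hn; rewrite simulation_replay//.
case E: (pi (h n)) => [x|] /=; last first.
  by move=> _; rewrite /h (sampled_history_stop nN E) -/(h n) E.
move=> /andP[xJ]; have [nE|nN'] := eqVneq n N; first by rewrite -E nE.
have nN1 : (n < N)%N by rewrite ltn_neqAle nN'.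
rewrite locations_restriction xJ andbT => /negP; case.
apply: locationsS (sampled_history_sub spliced_process pi H (w, w') nN1) _ _.
by rewrite /= -/(h n) E observe_location.
Qed.

(** Samples outside the interval and visited locations leave the restriction unchanged, so the
    restricted run is a slowed-down run of the simulated policy. *)
Lemma simulated_policy_final N : pi (h N) = None ->
  [/\ final_history Y (simulated_policy pi H w') (restriction al be H) w =
        restriction al be (h N),
      (#|` restriction al be H| <= #|` restriction al be (h N)|)%N &
      num_samples Y (simulated_policy pi H w') (restriction al be H) w =
        (#|` restriction al be (h N)|%:R - #|` restriction al be H|%:R)%:E].
Proof.
move=> pN; apply: (@time_change_stop _ _ _ Y _ _ w K) => //; last first.
  by rewrite simulated_policy_replay pN.
move=> n.
have KS : K n.+1 = restriction al be (if pi (h n) is Some x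
    then observe (h n) x (spliced_process x (w, w')) else h n) by [].
rewrite KS; case E: (pi (h n)) => [x|]; last by left.
have [xh|xh] := boolP (x \in locations (h n)); first by left;
  rewrite observe_visited.
have [xJ|xJ] := boolP (al <= x <= be); last by left;
  rewrite restriction_observe_out.
have xK : x \notin locations (K n) by rewrite locations_restriction negb_and xh.
right; exists x; split=> //.
  by rewrite simulated_policy_replay E //= xJ xK.
by rewrite restriction_observe_in// /spliced_process xJ.
Qed.

End Replay.

Lemma simulated_policy_inside pi H w' : measurable_process Y -> 0 <= al ->
  is_policy pi -> is_history H ->
  inside_policy al be (simulated_policy pi H w').
Proof.
move=> mY al0 ppi HH.
have inJ K x : simulated_policy pi H w' K = Some x ->
    al <= x <= be /\ x \notin locations K.
  rewrite /simulated_policy; case: xgetP => // _ -> [n [_ hK _]] xE.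
  by move: hK; rewrite xE => /andP[].
split=> //; apply: is_policyI => [K x _ /inJ[/andP[alx _] _]|m B mB].
  exact: le_trans alx.
pose h (t : m.-tuple (R * R)) := observed_history t.
have rh : random_history h by exact: random_observed_history.
(* The simulation is itself a run, of the process [Z] whose outcomes are the tuples; measurability
   of runs then covers it. *)
pose Z x t := simulated_observation (h t) x w'.
have mZ : measurable_process Z.
  apply: (@measurable_fun_if _ _ _ _
      (fun p : R * m.-tuple (R * R) => history_lookup (h p.2) p.1)
      (fun p => Y p.1 w') _ _ (fun p => al <= p.1 <= be)).
  - exact: measurable_half_strip.
  - apply: measurable_funTS; apply: (@measurable_fun_bool _ _ _ _ true).
    by rewrite setTI; apply: (measurable_set_itv al be measurable_fst).
  - apply: measurable_funTS; apply: measurable_history_lookup => //.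
    exact: (random_history_comp measurable_snd rh).
  - apply: (@measurable_comp _ _ _ _ _ _ ([set x : R | 0 <= x] `*` [set: T])
      (fun p : R * T => Y p.1 p.2) _ (fun p => (p.1, w'))) => //.
    + exact: measurable_half_strip.
    + by move=> _ [p [[p0 _] _] <-].
    + apply: measurable_funTS; exact: measurable_fun_pair.
pose g n t := sampled_history Z pi H n t.
have gE n t : simulation pi H w' (h t) n = g n t.
  by elim: n => [//|n IH]; rewrite /simulation/= -/(simulation _ _ _ _ _) IH.
have rg n : random_history (g n).
  by apply: random_sampled_history => //; exact: random_history_cst.
pose A n := [set t | simulation_halts (h t) (pi (g n t))].
have mA n : measurable (A n).
  pose x t := odflt 0 (pi (g n t)).
  have mx : measurable_fun [set: m.-tuple (R * R)] x.
    move=> _ C mC; rewrite setTI.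
    exact: (@measurable_policy _ _ _ pi (g n) [set o | C (odflt 0 o)]).
  rewrite (_ : A n = [set t | [set None] (pi (g n t))] `|`
     ([set t | [set o | if o is Some z then al <= z <= be else false] (pi (g n t))]
      `&` ~` [set t | x t \in locations (h t)])).
    apply: measurableU; last apply: measurableI.
    - apply: measurable_policy => //.
      by rewrite (_ : _ @^-1` _ = set0)//; apply/seteqP; split.
    - apply: measurable_policy => //.
      rewrite (_ : _ @^-1` _ = `[al, be]%classic); first exact: measurable_itv.
      by apply/seteqP; split=> z /=; rewrite in_itv.
    - by apply: measurableC; exact: measurable_locations.
  apply/seteqP; split=> t; rewrite /A /x /=.
    by case: (pi _) => [z|] /=; [move=> /andP[zJ /negP zh]; right|left].
  by case: (pi _) => [z|] //= [//|[-> /negP]].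
(* Split according to the first halting index [n], with the default [None] where there is none. *)
rewrite (_ : [set t | _] =
    (\bigcup_n ([set t | B (pi (g n t))] `&` A n `&`
       [set t | forall i : 'I_n, (~` A i) t])) `|`
    ((~` \bigcup_n A n) `&` [set t | B None])).
  apply: measurableU.
    apply: bigcupT_measurable => n; apply: measurableI.
      by apply: measurableI => //; exact: (measurable_policy ppi (rg n) mB).
    by apply: measurable_forall => i; exact: measurableC.
  apply: measurableI; first by apply: measurableC; exact: bigcupT_measurable.
  have [B0|nB0] := pselect (B None).
    by rewrite (_ : [set _ | _] = setT)//; apply/seteqP; split.
  by rewrite (_ : [set _ | _] = set0)//; apply/seteqP; split.
have spE t n : A n t -> (forall i : 'I_n, ~ A i t) ->
    simulated_policy pi H w' (h t) = pi (g n t).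
  move=> An nA; rewrite (@simulated_policyE _ _ _ _ n) ?gE// => i ni.
  by rewrite gE; apply/negP; exact: (nA (Ordinal ni)).
apply/seteqP; split=> t /=.
  have [ex|nex] := pselect (exists n, simulation_halts (h t) (pi (g n t))).
    case: (ex_minnP ex) => n An nmin; rewrite -/(h t) (@spE t n)//.
      move=> Bt; left; exists n => //; split; first by split.
      by move=> i /= /nmin; rewrite leqNgt ltn_ord.
    by move=> i /nmin; rewrite leqNgt ltn_ord.
  rewrite -/(h t) simulated_policyN => [Bt|n]; last first.
    by rewrite gE; apply/negP => hn; apply: nex; exists n.
  by right; split=> // -[n _ An]; apply: nex; exists n.
move=> [[n _ [[Bt An] nA]]|[nA B0]]; first by rewrite (spE t n).
rewrite simulated_policyN// => n; rewrite gE; apply/negP => hn.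
by apply: nA; exists n.
Qed.

Lemma measurable_spliced_process : measurable_process Y ->
  measurable_process spliced_process.
Proof.
move=> mY.
have m0 : measurable ([set x : R | 0 <= x] `*` [set: T]).
  exact: measurable_half_strip.
apply: (@measurable_fun_if _ _ _ _
    (fun p : R * (T * T) => Y p.1 p.2.1) (fun p => Y p.1 p.2.2) _ _
    (fun p => al <= p.1 <= be)).
- exact: measurable_half_strip.
- apply: measurable_funTS; apply: (@measurable_fun_bool _ _ _ _ true).
  by rewrite setTI; apply: (measurable_set_itv al be measurable_fst).
- apply: (@measurable_comp _ _ _ _ _ _ ([set x : R | 0 <= x] `*` [set: T])
    (fun p : R * T => Y p.1 p.2) _ (fun p => (p.1, p.2.1))) => //.
  + by move=> _ [p [[p0 _] _] <-].
  + apply: measurable_funTS; apply: measurable_fun_pair => //.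
    exact: measurableT_comp measurable_fst measurable_snd.
- apply: (@measurable_comp _ _ _ _ _ _ ([set x : R | 0 <= x] `*` [set: T])
    (fun p : R * T => Y p.1 p.2) _ (fun p => (p.1, p.2.2))) => //.
  + by move=> _ [p [[p0 _] _] <-].
  + apply: measurable_funTS; apply: measurable_fun_pair => //.
    exact: measurableT_comp measurable_snd measurable_snd.
Qed.

End Simulation.

(** * Conditional laws and the coupling *)

Section Exterior.
Context {R : realType}.
Implicit Types (H K : {fset R * R}) (x y al be : R).

(** The complement of the open interval: the endpoints belong to both [restriction] and [exterior],
    since each side needs them to be screened off from the other. *)
Definition exterior al be H : {fset R * R} :=
  [fset p in H | ~~ (al < p.1 < be)]%fset.

Lemma in_exterior al be H p :
  (p \in exterior al be H) = (p \in H) && ~~ (al < p.1 < be).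
Proof. by rewrite !inE. Qed.

Lemma locations_exterior al be H x :
  (x \in locations (exterior al be H)) = (x \in locations H) && ~~ (al < x < be).
Proof.
apply/idP/idP => [/locationsP[y]|/andP[/locationsP[y xyH] xJ]].
  by rewrite in_exterior => /andP[xyH ->]; rewrite (locations_mem xyH).
by apply/locationsP; exists y; rewrite in_exterior xyH.
Qed.

Lemma exterior_observe_in al be H x y : al < x < be ->
  exterior al be (observe H x y) = exterior al be H.
Proof.
move=> xJ; rewrite /observe; case: ifP => // _.
apply/fsetP => p; rewrite !in_exterior !inE.
by case: eqP => //= ->; rewrite xJ andbF.
Qed.

Lemma exterior_observe_out al be H x y : ~~ (al < x < be) ->
  exterior al be (observe H x y) = observe (exterior al be H) x y.
Proof.
move=> xJ; rewrite /observe locations_exterior xJ andbT.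
case: ifP => // _; apply/fsetP => p; rewrite !(in_exterior, inE).
by case: eqP => //= ->.
Qed.

End Exterior.

Section ConditionalLaws.
Context {d} {T : measurableType d} {R : realType}.
Variables (P : probability T R) (Y : R -> T -> R).
Variable cond : {fset R * R} -> probability T R.
Hypothesis Ymeas : measurable_process Y.
Hypothesis Hcond : conditional_laws P Y cond.
Implicit Types (H K : {fset R * R}) (x al be : R).

Lemma measurable_observation x : 0 <= x -> measurable_fun [set: T] (Y x).
Proof.
move=> x0; apply: (@measurable_comp _ _ _ _ _ _ ([set x : R | 0 <= x] `*` [set: T])
    (fun p : R * T => Y p.1 p.2) _ (pair x)) => //.
- exact: measurable_half_strip.
- by move=> _ [w _ <-].
Qed.

Lemma path_events_observation (J : set R) x (B : set R) : J x -> measurable B ->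
  path_events Y J (Y x @^-1` B).
Proof.
move=> Jx mB; apply: sub_sigma_algebra; exists x => //.
by exists B => //; rewrite setTI.
Qed.

(** [cond_past] at [be] drops the observations beyond [be], then [cond_future] at [al] drops those
    before [al]. *)
Lemma cond_restriction al be H x (B : set R) : is_history H ->
  al \in locations H -> be \in locations H -> al <= x <= be -> measurable B ->
  cond H (Y x @^-1` B) = cond (restriction al be H) (Y x @^-1` B).
Proof.
move=> HH alH beH /andP[alx xbe] mB.
have al0 : 0 <= al := is_history_ge0 HH alH.
rewrite (cond_past Hcond HH beH); last first.
  by apply: path_events_observation => //=;
    rewrite in_itv /= xbe (le_trans al0).
have sub : ([fset p in H | (p.1 <= be)%R] `<=` H)%fset.
  by apply/fsubsetP => p; rewrite !inE => /andP[].
rewrite (cond_future Hcond (s := al)) //; first last.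
- by apply: path_events_observation => //=; rewrite in_itv /= alx.
- have /locationsP[y aly] := alH.
  by apply/locationsP; exists y; rewrite !inE aly /= (le_trans alx).
- exact: is_historyS sub HH.
congr (cond _ _); apply/fsetP => p; rewrite !inE.
by rewrite -andbA (andbC (_ <= be)).
Qed.

Lemma cond_inside al be H K x (B : set R) : is_history H -> is_history K ->
  al \in locations H -> be \in locations H ->
  restriction al be H = restriction al be K ->
  al <= x <= be -> measurable B ->
  cond H (Y x @^-1` B) = cond K (Y x @^-1` B).
Proof.
move=> HH KH alH beH HK xJ mB; have /andP[alx xbe] := xJ.
have albe := le_trans alx xbe.
have : al \in locations (restriction al be H).
  by rewrite locations_restriction alH lexx albe.
have : be \in locations (restriction al be H).
  by rewrite locations_restriction beH lexx albe.
rewrite HK !locations_restriction => /andP[beK _] /andP[alK _].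
by rewrite (@cond_restriction al be H)// (@cond_restriction al be K)// HK.
Qed.

(** Left of [al] only observations up to [al] matter, right of [be] only those from [be] on; neither
    set meets the open interval. *)
Lemma cond_exterior al be H K x (B : set R) : is_history H -> is_history K ->
  al \in locations H -> be \in locations H ->
  exterior al be H = exterior al be K ->
  0 <= x -> ~~ (al <= x <= be) -> measurable B ->
  cond H (Y x @^-1` B) = cond K (Y x @^-1` B).
Proof.
move=> HH KH alH beH HK x0 xJ mB.
have : al \in locations (exterior al be H).
  by rewrite locations_exterior alH ltxx.
have : be \in locations (exterior al be H).
  by rewrite locations_exterior beH ltxx andbF.
rewrite HK !locations_exterior => /andP[beK _] /andP[alK _].
have HKp p : ~~ (al < p.1 < be) -> (p \in H) = (p \in K).
  move=> pJ; have : (p \in exterior al be H) = (p \in exterior al be K) by rewrite HK.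
  by rewrite !in_exterior pJ !andbT.
move: xJ; rewrite negb_and -!ltNge => /orP[xal|bex].
  have ev : path_events Y `[0, al] (Y x @^-1` B).
    by apply: path_events_observation => //=; rewrite in_itv /= x0 ltW.
  rewrite (cond_past Hcond HH alH ev) (cond_past Hcond KH alK ev).
  congr (cond _ _); apply/fsetP => p; rewrite !inE.
  have [pal|] := leP p.1 al; last by rewrite !andbF.
  by rewrite !andbT; apply: HKp; rewrite ltNge pal.
have ev : path_events Y `[be, +oo[ (Y x @^-1` B).
  by apply: path_events_observation => //=; rewrite in_itv /= ltW.
rewrite (cond_future Hcond HH beH ev) (cond_future Hcond KH beK ev).
congr (cond _ _); apply/fsetP => p; rewrite !inE.
have [pbe|] := leP be p.1; last by rewrite !andbF.
by rewrite !andbT; apply: HKp; rewrite negb_and -!leNgt pbe orbT.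
Qed.

Section RandomCond.
Context {d'} {S : measurableType d'}.
Variable h : S -> {fset R * R}.
Hypothesis rh : random_history h.

Lemma measurable_cond (A : set T) : measurable A ->
  measurable_fun [set: S] (fun s => cond (h s) A).
Proof.
move=> mA; apply: (measurable_random_history (F := fun K => cond K A)) rh.
by move=> n; exact: cond_measurable Hcond n A mA.
Qed.

Lemma measurable_cond_probability :
  measurable_fun [set: S] (fun s => cond (h s) : pprobability T R).
Proof.
apply: (measurability (@pset _ _ _ : set (set (pprobability T R)))) => //.
move=> _ -[_ [r r01] [A mA <-]] <-; rewrite setTI.
have := measurable_cond mA measurableT (emeasurable_itv `]-oo, r%:E[%R).
by rewrite setTI.
Qed.

Lemma measurable_integral_cond (g : S * T -> \bar R) :
  (forall z, 0 <= g z)%E -> measurable_fun [set: S * T] g ->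
  measurable_fun [set: S] (fun s => \int[cond (h s)]_w g (s, w))%E.
Proof.
move=> g0 mg; exact: (measurable_fun_integral_sfinite_kernel g
  (kprobability measurable_cond_probability) g0 mg).
Qed.

End RandomCond.

Lemma random_history_observation H x : is_history H -> 0 <= x ->
  random_history (fun w => observe H x (Y x w)).
Proof.
move=> HH x0; apply: (@random_history_observe _ _ _ (fun=> x)) => //.
  exact: measurable_observation.
exact: random_history_cst.
Qed.

(** [cond_disintegration] is the case of indicators; the general case is integration against a
    composition of kernels, where [unit] is a dummy parameter space. *)
Lemma integral_disintegration H x (g : T -> \bar R) : is_history H -> 0 <= x ->
  (forall w, 0 <= g w)%E -> measurable_fun [set: T] g ->
  (\int[cond H]_w g w =
   \int[cond H]_w \int[cond (observe H x (Y x w))]_w' g w')%E.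
Proof.
move=> HH x0 g0 mg.
have mk := measurable_cond_probability (random_history_comp
  (@measurable_snd _ _ unit T) (random_history_observation HH x0)).
have ml := measurable_cond_probability
  (random_history_cst (S := unit) HH).
have := integral_kcomp (kprobability ml) (kprobability mk) tt g0 mg.
move=> /= <-; apply: eq_measure_integral => A mA _ /=.
exact: (cond_disintegration Hcond HH x0 mA).
Qed.

Lemma eq_law_integral (mu nu : {measure set T -> \bar R}) (Z : T -> R)
    (g : R -> \bar R) : measurable_fun [set: T] Z ->
  (forall B : set R, measurable B -> mu (Z @^-1` B) = nu (Z @^-1` B)) ->
  measurable_fun [set: R] g ->
  (\int[mu]_w g (Z w) = \int[nu]_w g (Z w))%E.
Proof.
move=> mZ munu mg.
have ge0 (k : R -> \bar R) : (forall v, 0 <= k v)%E ->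
  measurable_fun [set: R] k ->
    (\int[mu]_w k (Z w) = \int[nu]_w k (Z w))%E.
  move=> k0 mk; have push (m : {measure set T -> \bar R}) :
      (\int[m]_w k (Z w) = \int[pushforward m Z]_v k v)%E.
    by rewrite [RHS](ge0_integral_pushforward mZ)// => v _; exact: k0.
  by rewrite !push; apply: eq_measure_integral => B mB _; exact: munu.
rewrite integralE [RHS]integralE.
have -> : ((fun w => g (Z w))^\+ = fun w => g^\+ (Z w))%E.
  by apply/funext => w; rewrite !funeposE.
have -> : ((fun w => g (Z w))^\- = fun w => g^\- (Z w))%E.
  by apply/funext => w; rewrite !funenegE.
by rewrite !ge0//; [exact: measurable_funeneg|exact: measurable_funepos].
Qed.

(** Under the law that also conditions on [Y x = v], the variable [Y x] equals [v] almost surely, so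
    the observed value can be frozen in the integrand. This isolates the first step of a run. *)
Lemma first_observation H x (g : T -> \bar R) (Phi : R -> T -> \bar R) :
  is_history H -> 0 <= x -> x \notin locations H ->
  (forall w, 0 <= g w)%E -> measurable_fun [set: T] g ->
  (forall v w, 0 <= Phi v w)%E -> (forall v, measurable_fun [set: T] (Phi v)) ->
  (forall w, g w = Phi (Y x w) w) ->
  (\int[cond H]_w g w =
   \int[cond H]_w \int[cond (observe H x (Y x w))]_w' Phi (Y x w) w')%E.
Proof.
move=> HH x0 xH g0 mg Phi0 mPhi gPhi.
rewrite (integral_disintegration HH x0)//.
apply: eq_integral => w0 _; move: (Y x w0) => v.
apply: ge0_ae_eq_integral => //.
pose A := Y x @^-1` [set v].
have mA : measurable A.
  by rewrite /A -[X in measurable X]setTI; exact: measurable_observation.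
exists (~` A); split; first exact: measurableC.
  have cA : cond (observe H x v) A = 1%E.
    apply: (cond_observed Hcond (p := (x, v))).
      exact: is_history_observe.
    by rewrite observe_fresh// !inE eqxx.
  transitivity (1 - cond (observe H x v) A)%E; first exact: probability_setC.
  by rewrite cA subee.
by move=> w /= nw Aw; apply: nw => _; rewrite gPhi Aw.
Qed.

(** * Independence of the samples inside and outside an interval *)

Section Coupling.
Variables (pi : {fset R * R} -> option R) (al be : R).
Variable F : {fset R * R} -> \bar R.
Hypotheses (ppi : is_policy pi) (F0 : forall K, (0 <= F K)%E).
Hypothesis mF : history_measurable F.

Let Y2 := spliced_process Y al be.

Let mrun H n : is_history H ->
  measurable_fun [set: T] (fun w => F (sampled_history Y pi H n w)).
Proof.
move=> HH; apply: measurable_random_history => //.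
by apply: random_sampled_history => //; exact: random_history_cst.
Qed.

Let mrun2 H n : is_history H ->
  measurable_fun [set: T * T] (fun w => F (sampled_history Y2 pi H n w)).
Proof.
move=> HH; apply: measurable_random_history => //.
apply: random_sampled_history => //; first exact: measurable_spliced_process.
exact: random_history_cst.
Qed.

(** The starting history depends on [v], so the run is regarded as a run on [R * T] from a random
    history. *)
Let mtheta H x n : is_history H -> 0 <= x -> measurable_fun [set: R] (fun v =>
  \int[cond (observe H x v)]_w F (sampled_history Y pi (observe H x v) n w))%E.
Proof.
move=> HH x0.
have rh : random_history (fun v : R => observe H x v).
  apply: (@random_history_observe _ _ _ (fun=> x) id) => //.
  exact: random_history_cst.
apply: (measurable_integral_cond rh
  (g := fun p => F (sampled_history Y pi (observe H x p.1) n p.2))) => //.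
pose Y' x (p : R * T) := Y x p.2.
have YE K p : sampled_history Y pi K n p.2 = sampled_history Y' pi K n p.
  by elim: n => [//|m IH] /=; rewrite IH.
under eq_fun do rewrite YE.
apply: measurable_random_history => //; apply: random_sampled_history => //.
  apply: (@measurable_comp _ _ _ _ _ _ ([set x : R | 0 <= x] `*` [set: T])
    (fun p : R * T => Y p.1 p.2) _ (fun p : R * (R * T) => (p.1, p.2.2))) => //.
  - exact: measurable_half_strip.
  - by move=> _ [p [p0 _] <-].
  - apply: measurable_funTS; apply: measurable_fun_pair => //.
    exact: measurableT_comp measurable_snd measurable_snd.
exact: (random_history_comp measurable_fst rh).
Qed.

(* By the Markov property the samples inside and outside [al, be] are
   independent, so that the run has the same law when they are taken from two
   independent outcomes. *)
Lemma coupling n H H1 H2 :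
  is_history H -> is_history H1 -> is_history H2 ->
  al \in locations H -> be \in locations H ->
  restriction al be H = restriction al be H1 ->
  exterior al be H = exterior al be H2 ->
  (\int[cond H]_w F (sampled_history Y pi H n w) =
   \int[cond H1 \x cond H2]_z F (sampled_history Y2 pi H n z))%E.
Proof.
(* [H1] and [H2] are kept separate from [H] because a new observation extends [H] together with only
   one of them. *)
elim: n H H1 H2 => [|n IH] H H1 H2 HH HH1 HH2 alH beH H1E H2E.
  have pT : (cond H1 \x cond H2)%E [set: T * T] = 1%E.
    rewrite -setXTT product_measure1E//.
    by rewrite [X in (X * _)%E]probability_setT [X in (_ * X)%E]probability_setT mule1.
  rewrite /= !integral_cst//= pT.
  by rewrite [X in (_ * X)%E]probability_setT.
(* If the policy stops or revisits a location, the first step changes neither run. *)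
have [stuck|] := boolP (if pi H is Some x then x \in locations H else true).
  have nextE d' (T' : measurableType d') (Z : R -> T' -> R) w :
      next_history Z pi H w = H.
    rewrite /next_history; case: (pi H) stuck => // x xH.
    by rewrite observe_visited.
  under eq_integral do rewrite sampled_historySr nextE.
  under [RHS]eq_integral do rewrite sampled_historySr nextE.
  exact: IH.
case E: (pi H) => [x|//] xH; have x0 : 0 <= x := policy_ge0 ppi HH E.
have oH v : is_history (observe H x v) by exact: is_history_observe.
have runS w : F (sampled_history Y pi H n.+1 w) =
    F (sampled_history Y pi (observe H x (Y x w)) n w).
  by rewrite sampled_historySr /next_history E.
have run2S z : F (sampled_history Y2 pi H n.+1 z) =
    F (sampled_history Y2 pi (observe H x (Y2 x z)) n z).
  by rewrite sampled_historySr /next_history E.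
have alo v : al \in locations (observe H x v).
  exact: locationsS (observe_sub _ _ _) _ alH.
have beo v : be \in locations (observe H x v).
  exact: locationsS (observe_sub _ _ _) _ beH.
rewrite (@first_observation H x _
  (fun v w => F (sampled_history Y pi (observe H x v) n w)))//; last 2 first.
- exact: mrun.
- by move=> v; exact: mrun.
have [xJ|xJ] := boolP (al <= x <= be).
  (* The endpoints are observed, so a new location is interior and the exterior of the history does
     not change. *)
  have xJ' : al < x < be.
    have /andP[alx xbe] := xJ; rewrite !lt_neqAle alx xbe !andbT.
    by apply/andP; split; apply: contraNneq xH; [move=> <-|move=> ->].
  have xH1 : x \notin locations H1.
    apply: contra xH => xH1; have : x \in locations (restriction al be H1).
      by rewrite locations_restriction xH1.
    by rewrite -H1E locations_restriction => /andP[].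
  rewrite (fubini_tonelli1 _ (mrun2 n.+1 HH) (fun z => F0 _))// /fubini_F.
  rewrite [RHS](@first_observation H1 x _ (fun v w =>
    \int[cond H2]_w' F (sampled_history Y2 pi (observe H x v) n (w, w')))%E)//;
      last 5 first.
  - by move=> w; exact: integral_ge0.
  - exact: (measurable_fun_fubini_tonelli_F _ (mrun2 n.+1 HH) (fun z => F0 _)).
  - by move=> v w; exact: integral_ge0.
  - by move=> v; exact: (measurable_fun_fubini_tonelli_F _ (mrun2 n (oH v)) (fun z => F0 _)).
  - move=> w; apply: eq_integral => w' _.
    by rewrite run2S /Y2 /spliced_process xJ.
  (* What remains is a function of [Y x] alone, so [cond H] may be replaced by [cond H1], under
     which [Y x] has the same law. *)
  rewrite [LHS](eq_law_integral (nu := cond H1) (measurable_observation x0) _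
    (mtheta n HH x0)); last first.
  - by move=> B mB; exact: (cond_inside HH HH1 alH beH H1E xJ mB).
  apply: eq_integral => w _; move: (Y x w) => v.
  rewrite (IH (observe H x v) (observe H1 x v) H2)//.
  - by rewrite (fubini_tonelli1 _ (mrun2 n (oH v)) (fun z => F0 _)).
  - exact: is_history_observe.
  - by rewrite !restriction_observe_in// H1E.
  - by rewrite exterior_observe_in.
have xJ' : ~~ (al < x < be).
  by apply: contra xJ => /andP[alx xbe]; rewrite !ltW.
have xH2 : x \notin locations H2.
  apply: contra xH => xH2; have : x \in locations (exterior al be H2).
    by rewrite locations_exterior xH2.
  by rewrite -H2E locations_exterior => /andP[].
(* For an observation outside, the roles of the two factors are exchanged: the outer integral is now
   over the second outcome. *)
rewrite (fubini_tonelli2 _ (mrun2 n.+1 HH) (fun z => F0 _))// /fubini_G.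
rewrite [RHS](@first_observation H2 x _ (fun v w' =>
  \int[cond H1]_w F (sampled_history Y2 pi (observe H x v) n (w, w')))%E)//;
    last 5 first.
- by move=> w; exact: integral_ge0.
- exact: (measurable_fun_fubini_tonelli_G _ (mrun2 n.+1 HH) (fun z => F0 _)).
- by move=> v w; exact: integral_ge0.
- by move=> v; exact: (measurable_fun_fubini_tonelli_G _ (mrun2 n (oH v)) (fun z => F0 _)).
- move=> w'; apply: eq_integral => w _.
  by rewrite run2S /Y2 /spliced_process (negbTE xJ).
rewrite [LHS](eq_law_integral (nu := cond H2) (measurable_observation x0) _
  (mtheta n HH x0)); last first.
- by move=> B mB; exact: (cond_exterior HH HH2 alH beH H2E x0 xJ mB).
apply: eq_integral => w _; move: (Y x w) => v.
rewrite (IH (observe H x v) H1 (observe H2 x v))//.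
- by rewrite (fubini_tonelli2 _ (mrun2 n (oH v)) (fun z => F0 _)).
- exact: is_history_observe.
- by rewrite restriction_observe_out.
- by rewrite !exterior_observe_out// H2E.
Qed.

End Coupling.

End ConditionalLaws.

(** * The reward *)

Section Reward.
Context {d} {T : measurableType d} {R : realType}.
Variables (P : probability T R) (Y : R -> T -> R).
Variable cond : {fset R * R} -> probability T R.
Variables (I : finType) (f : I -> R -> R) (M : R).
Hypothesis Ymeas : measurable_process Y.
Hypothesis Hcond : conditional_laws P Y cond.
Hypothesis I0 : (0 < #|I|)%N.
Hypothesis fmeas : forall i, measurable_fun [set: R] (f i).
Hypothesis fM : forall i z, `|f i z| <= M.
Implicit Types (H K : {fset R * R}) (x al be : R).

Definition payoff K x : \bar R :=
  (\big[maxe/-oo]_(i : I) 'E_(cond K)[fun w => f i (Y x w)])%E.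

Lemma abse_le_fin (u : \bar R) (r : R) :
  (`|u| <= r%:E)%E = ((- r)%:E <= u <= r%:E)%E.
Proof. by case: u => [u| |] //=; rewrite ?leye_eq ?leeNy_eq ?lee_fin ?ler_norml ?andbF. Qed.

Lemma measurable_bigmaxe d' (S : measurableType d') (D : set S)
    (F : I -> S -> \bar R) :
  (forall i, measurable_fun D (F i)) ->
  measurable_fun D (fun s => \big[maxe/-oo]_(i : I) F i s)%E.
Proof.
move=> mF; rewrite unlock; elim: (index_enum I) => [|i r IH] /=.
  exact: measurable_cst.
exact: measurable_maxe.
Qed.

Lemma measurable_payoff d' (S : measurableType d') (h : S -> {fset R * R}) al be :
  0 <= al -> random_history h ->
  measurable_fun [set: S * R]
    (fun p => if al <= p.2 <= be then payoff (h p.1) p.2 else 0%E).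
Proof.
(* Joint measurability of [Y] is assumed at nonnegative times only; extension by 0 makes it hold on
   all of [R * T]. *)
move=> al0 rh; pose Y0 x w := if 0 <= x then Y x w else 0.
have mY0 : measurable_fun [set: R * T] (fun p => Y0 p.1 p.2).
  apply: (@measurable_fun_if _ _ _ _ (fun p : R * T => Y p.1 p.2) (fun=> 0)
    _ _ (fun p => 0 <= p.1)) => //; last first.
  - rewrite setTI (_ : _ @^-1` _ = [set x : R | 0 <= x] `*` [set: T])//.
    by apply/seteqP; split=> p /=; [|case].
  - exact: measurable_fun_ler.
pose F i (p : S * R) := (\int[cond (h p.1)]_w (f i (Y0 p.2 w))%:E)%E.
have mF i : measurable_fun [set: S * R] (F i).
  have rh' : random_history (fun p : S * R => h p.1).
    exact: (random_history_comp measurable_fst rh).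
  pose g (q : S * R * T) := Y0 q.1.2 q.2.
  have mg : measurable_fun [set: S * R * T] g.
    apply: (measurableT_comp mY0 (g := fun q : S * R * T => (q.1.2, q.2))).
    apply: measurable_fun_pair => //.
    exact: measurableT_comp measurable_snd measurable_fst.
  have mfg : measurable_fun [set: S * R * T] (fun q => (f i (g q))%:E).
    by apply/measurable_EFinP; exact: measurableT_comp mg.
  have -> : F i = (fun p => \int[cond (h p.1)]_w (EFin \o (f i \o g))^\+ (p, w) -
      \int[cond (h p.1)]_w (EFin \o (f i \o g))^\- (p, w))%E.
    apply/funext => p; rewrite /F integralE.
    by congr (_ - _)%E; apply: eq_integral => w _; rewrite ?funeposE ?funenegE.
  apply: emeasurable_funB.
    apply: (measurable_integral_cond Hcond rh' (g := (EFin \o (f i \o g))^\+%E)) => //.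
    exact: measurable_funepos.
  apply: (measurable_integral_cond Hcond rh' (g := (EFin \o (f i \o g))^\-%E)) => //.
  exact: measurable_funeneg.
rewrite (_ : (fun _ => _) = fun p : S * R =>
    if al <= p.2 <= be then (\big[maxe/-oo]_(i : I) F i p)%E else 0%E).
  apply: measurable_fun_ifT => //; last exact: measurable_bigmaxe.
  apply: (@measurable_fun_bool _ _ _ _ true); rewrite setTI.
  exact: (measurable_set_itv al be measurable_snd).
apply/funext => -[s x] /=; case: ifP => // /andP[alx _].
apply: eq_bigr => i _; rewrite unlock /F; apply: eq_integral => w _.
by rewrite /Y0/= (le_trans al0 alx).
Qed.

Lemma rewardE al be K : reward Y cond f al be K =
  (\int[lebesgue_measure]_x if (al <= x <= be)%R then payoff K x else 0)%E.
Proof.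
rewrite /reward integral_mkcond; apply: eq_integral => x _.
by rewrite patchE mem_setE in_itv.
Qed.

Lemma history_measurable_reward al be : 0 <= al ->
  history_measurable (reward Y cond f al be).
Proof.
move=> al0; apply: history_measurableI => n.
have mg := measurable_payoff be al0 (@random_observed_history R n).
set g := (X in measurable_fun _ X) in mg.
rewrite (_ : (fun _ => _) = fun t => (fubini_F lebesgue_measure g^\+ t -
    fubini_F lebesgue_measure g^\- t)%E).
  apply: emeasurable_funB.
    apply: measurable_fun_fubini_tonelli_F; first exact: measurable_funepos.
    by move=> z; exact: funepos_ge0.
  apply: measurable_fun_fubini_tonelli_F; first exact: measurable_funeneg.
  by move=> z; exact: funeneg_ge0.
apply/funext => t; rewrite rewardE integralE /fubini_F.
by congr (_ - _)%E; apply: eq_integral => x _; rewrite ?funeposE ?funenegE.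
Qed.

Lemma measurable_payoff_itv K al be : is_history K -> 0 <= al ->
  measurable_fun (`[al, be] : set R) (payoff K).
Proof.
move=> HK al0.
have := measurable_payoff be al0 (random_history_cst (S := unit) HK).
move=> /measurable_fun_pair2 -/(_ tt) /= mg.
apply: eq_measurable_fun (measurable_funTS mg) => x.
by rewrite inE /= in_itv /= => ->.
Qed.

Lemma abse_payoff_le K x : 0 <= x -> (`|payoff K x| <= M%:E)%E.
Proof.
move=> x0.
have EM i : (`|'E_(cond K)[fun w => f i (Y x w)]| <= M%:E)%E.
  have mfY : measurable_fun [set: T] (fun w => (f i (Y x w))%:E).
    apply/measurable_EFinP; apply: measurableT_comp => //.
    exact: measurable_observation.
  rewrite unlock; apply: le_trans (le_abse_integral _ measurableT mfY) _.
  apply: (@le_trans _ _ (M%:E * cond K [set: T])%E).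
    apply: integral_le_bound => //.
      by rewrite lee_fin (le_trans _ (fM i 0)).
    by apply: aeW => w _ /=; rewrite lee_fin.
  by rewrite [X in (_ * X)%E]probability_setT mule1.
(* Without an index the maximum would be [-oo] and no lower bound could hold. *)
have [i _] : exists i : I, true by case/card_gt0P: I0 => i _; exists i.
rewrite abse_le_fin /payoff; apply/andP; split.
  apply: (@le_trans _ _ ('E_(cond K)[fun w => f i (Y x w)])%E).
    by have := EM i; rewrite abse_le_fin => /andP[].
  by rewrite (bigD1 i)//= le_max lexx.
rewrite unlock; elim: (index_enum I) => [|j r IH] /=; first exact: leNye.
by rewrite ge_max IH andbT; have := EM j; rewrite abse_le_fin => /andP[].
Qed.

Lemma abse_reward_le K al be : is_history K -> 0 <= al -> al <= be ->
  (`|reward Y cond f al be K| <= (M * (be - al))%:E)%E.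
Proof.
move=> HK al0 albe; have mp := @measurable_payoff_itv K al be HK al0.
have [i _] : exists i : I, true by case/card_gt0P: I0 => i _; exists i.
apply: (@le_trans _ _
    (\int[lebesgue_measure]_(x in `[al, be]) `|payoff K x|)%E).
  exact: (le_abse_integral lebesgue_measure (measurable_itv _) mp).
apply: (@le_trans _ _ (M%:E * lebesgue_measure (`[al, be] : set R))%E).
  apply: integral_le_bound => //.
    by rewrite lee_fin (le_trans _ (fM i 0)).
  apply: aeW => x /=; rewrite in_itv /= => /andP[alx _].
  by apply: abse_payoff_le; exact: le_trans alx.
rewrite lebesgue_measure_itv /= lte_fin; case: ifPn => [_|].
  by rewrite -EFinB -EFinM.
by rewrite -leNgt => beal; rewrite mule0 (_ : be = al) ?subrr ?mulr0//;
   apply/eqP; rewrite eq_le beal albe.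
Qed.

Lemma reward_split K al s be : is_history K -> 0 <= al -> al <= s -> s <= be ->
  (reward Y cond f al be K =
   reward Y cond f al s K + reward Y cond f s be K)%E.
Proof.
move=> HK al0 als sbe; rewrite /reward -/(payoff K).
have itvU : (`[al, be]%classic : set R) = `[al, s] `|` `]s, be].
  apply/seteqP; split=> x /=; rewrite !in_itv /=.
    move=> /andP[alx xbe]; have [xs|sx] := leP x s; first by left; rewrite alx.
    by right.
  move=> [/andP[-> xs]|/andP[sx ->]]; first exact: le_trans sbe.
  by rewrite andbT (le_trans als)// ltW.
rewrite itvU integral_setU//; last first.
- apply/disj_setPS => x [] /=; rewrite !in_itv /= => /andP[_ xs] /andP[sx _].
  by move: sx; rewrite ltNge xs.
- by rewrite -itvU; exact: measurable_payoff_itv.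
congr (_ + _)%E; rewrite integral_itv_obnd_cbnd//.
apply: measurable_funS (@measurable_payoff_itv K s be HK (le_trans al0 als)) => //.
by move=> x /=; rewrite !in_itv /= => /andP[/ltW -> ->].
Qed.

(** The integrand involves only laws of single observations [Y x], so [cond_restriction]
    suffices. *)
Lemma reward_restriction K al be : is_history K ->
  al \in locations K -> be \in locations K ->
  reward Y cond f al be K = reward Y cond f al be (restriction al be K).
Proof.
move=> HK alK beK; apply: eq_integral => x; rewrite inE /= in_itv /= => xJ.
have x0 : 0 <= x by case/andP: xJ => alx _;
  exact: le_trans (is_history_ge0 HK alK) alx.
apply: eq_bigr => i _; rewrite unlock.
apply: (eq_law_integral (g := EFin \o f i)).
- exact: measurable_observation.
- by move=> B mB; exact: (cond_restriction Hcond HK alK beK xJ mB).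
- exact/measurable_EFinP.
Qed.

End Reward.

(** * Values of policies *)

(** The integral of [v] may be infinite. Writing [g] for [u - v], the identity [g^\- + u = g^\+ + v]
    involves nonnegative functions only, and after integration the finite terms can be cancelled. *)
Lemma integral_ge0B d (T : measurableType d) (R : realType)
    (mu : {measure set T -> \bar R}) (u v : T -> \bar R) :
  measurable_fun [set: T] u -> measurable_fun [set: T] v ->
  (forall w, 0 <= u w < +oo)%E -> (forall w, 0 <= v w)%E ->
  (\int[mu]_w u w < +oo)%E ->
  (\int[mu]_w (u w - v w) = \int[mu]_w u w - \int[mu]_w v w)%E.
Proof.
move=> mu_ mv u0 v0 iu.
pose g w := (u w - v w)%E.
have mg : measurable_fun [set: T] g by exact: emeasurable_funB.
have mgp := measurable_funepos mg; have mgn := measurable_funeneg mg.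
have u0' w : (0 <= u w)%E by case/andP: (u0 w).
have gpu w : (g^\+ w <= u w)%E.
  rewrite funeposE ge_max u0' andbT /g; move: (u0 w) (v0 w).
  case: (u w) => [a| |]; [|by rewrite ltxx andbF|by []];
    case: (v w) => [b| |]//; last by rewrite /= leNye.
  by rewrite -EFinB !lee_fin => _ b0; rewrite gerBl.
have key w : (g^\- w + u w = g^\+ w + v w)%E.
  rewrite funeposE funenegE /g; move: (u0 w) (v0 w).
  case: (u w) => [a| |]; [|by rewrite ltxx andbF|by []];
    case: (v w) => [b| |]//; last first.
    by move=> _ _; rewrite /= maxye maxNye add0e.
  rewrite -EFinB -EFinN -!EFin_max -!EFinD => _ _; congr EFin.
  rewrite !maxEle; case: ifPn; case: ifPn; rewrite -?ltNge => h1 h2; lra.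
have igp : (\int[mu]_w g^\+ w \is a fin_num)%E.
  rewrite ge0_fin_numE; last by apply: integral_ge0 => w _; exact: funepos_ge0.
  apply: le_lt_trans iu; exact: ge0_le_integral.
have iu' : (\int[mu]_w u w \is a fin_num)%E.
  by rewrite ge0_fin_numE//; exact: integral_ge0.
have : (\int[mu]_w g^\- w + \int[mu]_w u w = \int[mu]_w g^\+ w + \int[mu]_w v w)%E.
  by rewrite -!ge0_integralD//; apply: eq_integral => w _; exact: key.
have -> : (\int[mu]_w (u w - v w) = \int[mu]_w g^\+ w - \int[mu]_w g^\- w)%E.
  exact: integralE.
have : (0 <= \int[mu]_w g^\- w)%E.
  by apply: integral_ge0 => w _; exact: funeneg_ge0.
have : (0 <= \int[mu]_w v w)%E by exact: integral_ge0.
move: igp iu'.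
move: (integral _ _ g^\+%E) (integral _ _ g^\-%E) (integral _ _ u) (integral _ _ v).
move=> [p| |] [n| |] [a| |] [b| |] //= _ _ _ _.
by move=> [nab]; congr EFin; lra.
Qed.

(** * Integrals of functions of the final history *)

Section Stopped.
Context {d} {S : measurableType d} {R : realType}.
Variables (Z : R -> S -> R) (pi : {fset R * R} -> option R) (H : {fset R * R}).
Implicit Types (F : {fset R * R} -> \bar R) (K : {fset R * R}) (s : S).

(** The value 0 before stopping makes the sequence along a run nondecreasing when [F] is
    nonnegative, so statements about finitely many steps pass to the limit by monotone
    convergence. *)
Definition at_stop F K : \bar R := if pi K is Some _ then 0%E else F K.

(* [F] of the final history, and 0 when the policy never stops *)
Definition stopped F s : \bar R :=
  limn (fun n => at_stop F (sampled_history Z pi H n s)).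

Lemma stoppedE F N s : pi (sampled_history Z pi H N s) = None ->
  stopped F s = F (sampled_history Z pi H N s).
Proof.
move=> pN; apply/cvg_lim => //; apply: cvg_near_cst; exists N => // n /= Nn.
by rewrite (sampled_history_stop Nn pN) /at_stop pN.
Qed.

Lemma stopped_eq0 F s : (forall n, pi (sampled_history Z pi H n s) <> None) ->
  stopped F s = 0%E.
Proof.
move=> np; apply/cvg_lim => //; apply: cvg_near_cst; exists 0%N => // n _.
by have := np n; rewrite /at_stop; case: (pi _).
Qed.

Lemma stopped_final F N s : pi (sampled_history Z pi H N s) = None ->
  stopped F s = F (final_history Z pi H s).
Proof. by move=> pN; rewrite (stoppedE F pN);
  have [->] := final_historyE pN. Qed.

Lemma stoppedP s :
  (exists N, pi (sampled_history Z pi H N s) = None) \/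
  (forall n, pi (sampled_history Z pi H n s) <> None).
Proof.
have [ex|nex] := pselect (exists N, pi (sampled_history Z pi H N s) = None).
  by left.
by right => n pn; apply: nex; exists n.
Qed.

Lemma stopped_ge0 F s : (forall K, 0 <= F K)%E -> (0 <= stopped F s)%E.
Proof.
by move=> F0; have [[N pN]|np] := stoppedP s;
   [rewrite (stoppedE F pN)|rewrite stopped_eq0].
Qed.

Lemma le_stopped F G s : (forall K, 0 <= G K)%E ->
  (forall n, is_history (sampled_history Z pi H n s) ->
     (H `<=` sampled_history Z pi H n s)%fset ->
     (F (sampled_history Z pi H n s) <= G (sampled_history Z pi H n s))%E) ->
  is_policy pi -> is_history H ->
  (stopped F s <= stopped G s)%E.
Proof.
move=> G0 FG ppi HH; have [[N pN]|np] := stoppedP s;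
  last by rewrite !stopped_eq0.
rewrite !(stoppedE _ pN); apply: FG; first exact: is_history_sampled.
exact: (sampled_history_sub Z pi H s (leq0n N)).
Qed.

Hypotheses (mZ : measurable_process Z) (ppi : is_policy pi) (HH : is_history H).

Let rh n : random_history (fun s => sampled_history Z pi H n s).
Proof. by apply: random_sampled_history => //; exact: random_history_cst. Qed.

Lemma measurable_stop n : measurable [set s | pi (sampled_history Z pi H n s) = None].
Proof.
apply: (measurable_policy (B := [set None]) ppi (rh n)).
by rewrite (_ : _ @^-1` _ = set0)//; apply/seteqP; split.
Qed.

Lemma measurable_num_samples_pinfty :
  measurable [set s | num_samples Z pi H s = +oo%E].
Proof.
rewrite (_ : [set s | _] =
    ~` \bigcup_n [set s | pi (sampled_history Z pi H n s) = None]).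
  by apply: measurableC; apply: bigcupT_measurable => n; exact: measurable_stop.
apply/seteqP; split=> s /=.
  by move=> /num_samples_pinfty np [n _ /np].
by move=> np; apply/num_samples_pinfty => n pn; apply: np; exists n.
Qed.

Lemma history_measurable_at_stop F : history_measurable F ->
  history_measurable (at_stop F).
Proof.
move=> mF; apply: history_measurableI => n.
pose E := [set t : n.-tuple (R * R) | pi (observed_history t) = None].
have mE : measurable E.
  apply: (measurable_policy (B := [set None]) ppi (@random_observed_history R n)).
  by rewrite (_ : _ @^-1` _ = set0)//; apply/seteqP; split.
rewrite (_ : (fun _ => _) =
    fun t => if t \in E then F (observed_history t) else 0%E).
  apply: measurable_fun_ifT => //; first exact: measurable_fun_mem.
  exact: (measurable_random_history mF (@random_observed_history R n)).
apply/funext => t; rewrite /at_stop /E; case: ifPn => [/set_mem/= ->//|].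
by case E': (pi _) => [//|] /negP[]; apply: mem_set.
Qed.

Let at_stop_ge0 F K : (forall K, 0 <= F K)%E -> (0 <= at_stop F K)%E.
Proof. by rewrite /at_stop; case: (pi _). Qed.

Let at_stop_nd F s : (forall K, 0 <= F K)%E ->
  {homo (fun n => at_stop F (sampled_history Z pi H n s)) :
    m n / (m <= n)%N >-> (m <= n)%E}.
Proof.
move=> F0 m n mn; rewrite {1}/at_stop.
case E: (pi _) => [x|]; first exact: at_stop_ge0.
by rewrite (sampled_history_stop mn E) /at_stop E.
Qed.

Let measurable_at_stop F n : history_measurable F ->
  measurable_fun [set: S] (fun s => at_stop F (sampled_history Z pi H n s)).
Proof.
move=> mF; apply: measurable_random_history => //.
exact: history_measurable_at_stop.
Qed.

Lemma measurable_stopped F : (forall K, 0 <= F K)%E -> history_measurable F ->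
  measurable_fun [set: S] (stopped F).
Proof.
move=> F0 mF.
apply: (emeasurable_fun_cvg
  (fun n s => at_stop F (sampled_history Z pi H n s))).
  by move=> n; exact: measurable_at_stop.
move=> s _; apply: ereal_nondecreasing_is_cvgn.
exact: at_stop_nd.
Qed.

Lemma integral_stopped (mu : {measure set S -> \bar R}) F :
  (forall K, 0 <= F K)%E -> history_measurable F ->
  (\int[mu]_s stopped F s =
   limn (fun n => \int[mu]_s at_stop F (sampled_history Z pi H n s)))%E.
Proof.
move=> F0 mF; apply: monotone_convergence => //.
- by move=> n; exact: measurable_at_stop.
- by move=> n s _; exact: at_stop_ge0.
- by move=> s _; exact: at_stop_nd.
Qed.

End Stopped.

Section CouplingStopped.
Context {d} {T : measurableType d} {R : realType}.
Variables (P : probability T R) (Y : R -> T -> R).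
Variable cond : {fset R * R} -> probability T R.
Hypothesis Ymeas : measurable_process Y.
Hypothesis Hcond : conditional_laws P Y cond.

Lemma coupling_stopped pi al be F H H1 H2 :
  is_policy pi -> (forall K, 0 <= F K)%E -> history_measurable F ->
  is_history H -> is_history H1 -> is_history H2 ->
  al \in locations H -> be \in locations H ->
  restriction al be H = restriction al be H1 ->
  exterior al be H = exterior al be H2 ->
  (\int[cond H]_w stopped Y pi H F w =
   \int[cond H1 \x cond H2]_z stopped (spliced_process Y al be) pi H F z)%E.
Proof.
move=> ppi F0 mF HH HH1 HH2 alH beH H1E H2E.
rewrite !integral_stopped//; last exact: measurable_spliced_process.
congr (limn _); apply/funext => n.
apply: (coupling Ymeas Hcond) => //; last exact: history_measurable_at_stop.
by move=> K; rewrite /at_stop; case: (pi _).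
Qed.

End CouplingStopped.

Section NeverStops.
Context {d} {S : measurableType d} {R : realType}.
Variables (Z : R -> S -> R) (pi : {fset R * R} -> option R) (H : {fset R * R}).

Lemma num_samples_finite s : num_samples Z pi H s <> +oo%E ->
  exists N, pi (sampled_history Z pi H N s) = None.
Proof.
by case: (stoppedP Z pi H s) => // np; case; exact/num_samples_pinfty.
Qed.

Lemma num_samples_stop N s : pi (sampled_history Z pi H N s) = None ->
  num_samples Z pi H s <> +oo%E.
Proof. by move=> pN /num_samples_pinfty/(_ N). Qed.

(** Stopping is the case [F = 1], so whatever transfers integrals of [stopped F] also transfers the
    probability of stopping. *)
Lemma stopped_cst1 s : stopped Z pi H (fun=> 1%E) s =
  (\1_(~` [set s | num_samples Z pi H s = +oo%E]) s)%:E.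
Proof.
rewrite indicE; case: (stoppedP Z pi H s) => [[N pN]|np].
  by rewrite (stoppedE _ pN) mem_set//; exact: num_samples_stop pN.
rewrite stopped_eq0// memNset//= => ns; apply: ns.
exact/num_samples_pinfty.
Qed.

Lemma stoppedD F G s : (stopped Z pi H (fun K => F K + G K) s =
  stopped Z pi H F s + stopped Z pi H G s)%E.
Proof.
case: (stoppedP Z pi H s) => [[N pN]|np]; first by rewrite !(stoppedE _ pN).
by rewrite !stopped_eq0// adde0.
Qed.

Lemma integral_stopped_cst1 (mu : {measure set S -> \bar R}) :
  measurable_process Z -> is_policy pi -> is_history H ->
  (\int[mu]_s stopped Z pi H (fun=> 1%E) s =
   mu (~` [set s | num_samples Z pi H s = +oo%E]))%E.
Proof.
move=> mZ ppi HH; under eq_integral do rewrite stopped_cst1.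
rewrite integral_indic ?setIT//.
by apply: measurableC; exact: measurable_num_samples_pinfty.
Qed.

End NeverStops.

Section Counts.
Context {R : realType}.
Implicit Types (F : {fset R * R} -> \bar R) (K : {fset R * R}).

(** At the final history of a run started from [m] observations this is the number of samples; the
    maximum with 0 keeps it nonnegative at all other sets. *)
Definition extra_card m K : \bar R := (Num.max 0 (#|` K|%:R - m%:R : R))%:E.

Lemma extra_card_ge0 m K : (0 <= extra_card m K)%E.
Proof. by rewrite lee_fin le_max lexx. Qed.

Lemma extra_cardE m K : (m <= #|` K|)%N ->
  extra_card m K = (#|` K|%:R - m%:R)%:E.
Proof. by move=> mK; rewrite /extra_card max_r// subr_ge0 ler_nat. Qed.

Lemma history_measurable_extra_card m : history_measurable (extra_card m).
Proof.
apply: history_measurableI => n; apply/measurable_EFinP.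
apply: measurable_maxr => //; apply: measurable_funB => //.
exact: (measurable_history_card (@random_observed_history R n)).
Qed.

Lemma history_measurable_restriction al be F : history_measurable F ->
  history_measurable (fun K => F (restriction al be K)).
Proof.
move=> mF; apply: history_measurableI => n.
apply: (measurable_random_history mF).
exact: (random_history_restriction al be (@random_observed_history R n)).
Qed.

Lemma history_measurable_cst (r : \bar R) : history_measurable (fun=> r).
Proof. by move=> n; exact: measurable_cst. Qed.

End Counts.

(** * Policy values as shifted reward minus cost *)

Section Values.
Context {d} {T : measurableType d} {R : realType}.
Variables (P : probability T R) (Y : R -> T -> R).
Variable cond : {fset R * R} -> probability T R.
Variables (I : finType) (f : I -> R -> R) (M c : R).
Hypothesis Ymeas : measurable_process Y.
Hypothesis Hcond : conditional_laws P Y cond.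
Hypothesis I0 : (0 < #|I|)%N.
Hypothesis fmeas : forall i, measurable_fun [set: R] (f i).
Hypothesis fM : forall i z, `|f i z| <= M.
Hypothesis c0 : 0 < c.
Implicit Types (H K : {fset R * R}) (x al be : R).
Implicit Types (pi sigma : {fset R * R} -> option R).

(* The reward shifted to be nonnegative; the maximum with 0 only matters at
   inconsistent sets of observations. *)
Definition shifted_reward al be K : \bar R :=
  maxe 0%E (reward Y cond f al be K + (M * (be - al))%:E)%E.

Lemma shifted_reward_ge0 al be K : (0 <= shifted_reward al be K)%E.
Proof. by rewrite /shifted_reward le_max lexx. Qed.

Lemma reward_bounds al be K : is_history K -> 0 <= al -> al <= be ->
  exists2 r : R, reward Y cond f al be K = r%:E &
    - (M * (be - al)) <= r <= M * (be - al).
Proof.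
move=> HK al0 albe.
have := abse_reward_le Ymeas Hcond I0 fmeas fM HK al0 albe.
rewrite abse_le_fin; case: (reward _ _ _ _ _ _) => [r| |].
- by rewrite !lee_fin => rb; exists r.
- by rewrite leye_eq andbF.
- by rewrite leeNy_eq.
Qed.

Lemma shifted_rewardE al be K : is_history K -> 0 <= al -> al <= be ->
  shifted_reward al be K = (reward Y cond f al be K + (M * (be - al))%:E)%E.
Proof.
move=> HK al0 albe; rewrite /shifted_reward max_r//.
have [r -> /andP[rb _]] := reward_bounds HK al0 albe.
by rewrite -EFinD lee_fin; lra.
Qed.

Lemma shifted_reward_le al be K : is_history K -> 0 <= al -> al <= be ->
  (shifted_reward al be K <= (M * (be - al) *+ 2)%:E)%E.
Proof.
move=> HK al0 albe; rewrite shifted_rewardE//.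
have [r -> /andP[_ rb]] := reward_bounds HK al0 albe.
by rewrite -EFinD lee_fin mulr2n; lra.
Qed.

Lemma history_measurable_shifted_reward al be : 0 <= al ->
  history_measurable (shifted_reward al be).
Proof.
move=> al0 n; apply: measurable_maxe => //; apply: emeasurable_funD => //.
exact: (history_measurable_reward Ymeas Hcond fmeas be al0 (n := n)).
Qed.

Section PolicyValue.
Variables (al be : R) (H : {fset R * R}) (pi : {fset R * R} -> option R).
Hypotheses (al0 : 0 <= al) (albe : al <= be) (HH : is_history H).
Hypothesis ppi : is_policy pi.

Let L := M * (be - al).
Let L0 : 0 <= L.
Proof.
have [r _ /andP[r1 r2]] := reward_bounds HH al0 albe.
by rewrite /L; lra.
Qed.

Let u := stopped Y pi H (shifted_reward al be).
Let v := stopped Y pi H (extra_card #|` H|).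

Let mu_ : measurable_fun [set: T] u.
Proof.
apply: measurable_stopped => //; first exact: shifted_reward_ge0.
exact: history_measurable_shifted_reward.
Qed.

Let mv : measurable_fun [set: T] v.
Proof.
apply: measurable_stopped => //; first exact: extra_card_ge0.
exact: history_measurable_extra_card.
Qed.

Let u0 w : (0 <= u w)%E.
Proof. exact/stopped_ge0/shifted_reward_ge0. Qed.

Let v0 w : (0 <= v w)%E.
Proof. exact/stopped_ge0/extra_card_ge0. Qed.

Let u_le w : (u w <= (L *+ 2)%:E)%E.
Proof.
rewrite /u; case: (stoppedP Y pi H w) => [[N pN]|np].
  rewrite (stoppedE _ pN); apply: shifted_reward_le => //.
  exact: is_history_sampled.
by rewrite stopped_eq0// lee_fin mulrn_wge0.
Qed.

(** The reward is at most [M * (be - al)] and the shift adds the same amount; a run that never stops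
    contributes 0. *)
Lemma integral_stopped_reward_le (mu : probability T R) :
  (\int[mu]_w stopped Y pi H (shifted_reward al be) w <=
   (M * (be - al) *+ 2)%:E)%E.
Proof.
apply: (@le_trans _ _ (\int[mu]_w (cst (L *+ 2)%:E w))%E).
  by apply: ge0_le_integral => //= w _.
by rewrite integral_cst//= [X in (_ * X)%E]probability_setT mule1.
Qed.

Lemma policy_value_stopped :
  cond H [set w | num_samples Y pi H w = +oo%E] = 0%E ->
  (policy_value Y cond f c al be H pi =
   \int[cond H]_w stopped Y pi H (shifted_reward al be) w -
   ((M * (be - al))%:E +
    c%:E * \int[cond H]_w stopped Y pi H (extra_card #|` H|) w))%E.
Proof.
move=> ns; rewrite /policy_value ns ltxx.
set N := [set w | _] in ns.
have mN : measurable N by exact: measurable_num_samples_pinfty.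
(* On the null set [N] the cost is infinite and the integrand is [-oo], whereas the stopped
   functions vanish; [g] records both cases. *)
pose g w := (if w \in N then -oo else u w - (L%:E + c%:E * v w))%E.
have mcv : measurable_fun [set: T] (fun w => L%:E + c%:E * v w)%E.
  by apply: emeasurable_funD => //; exact: emeasurable_funM.
have muv : measurable_fun [set: T] (fun w => u w - (L%:E + c%:E * v w))%E.
  exact: emeasurable_funB.
have cv0 w : (0 <= c%:E * v w)%E by rewrite mule_ge0// lee_fin ltW.
transitivity (\int[cond H]_w g w)%E.
  apply: eq_integral => w _; rewrite /g.
  have Hfin : is_history (final_history Y pi H w) by exact: is_history_sampled.
  have [r rE _] := reward_bounds Hfin al0 albe.
  case: ifPn => [/set_mem/= ->|/negP nN].
    by rewrite rE gt0_muley ?lte_fin.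
  have [|n pn] := @num_samples_finite _ _ _ Y pi H w.
    by move=> nsw; apply: nN; rewrite mem_set.
  rewrite /u /v !(stopped_final _ pn) shifted_rewardE// rE.
  have [-> le ->] := final_historyE pn.
  rewrite extra_cardE// -!EFinM -!EFinD; congr EFin.
  by rewrite /L; lra.
transitivity (\int[cond H]_w (u w - (L%:E + c%:E * v w)))%E.
  apply: ae_eq_integral => //.
    apply: measurable_fun_ifT => //; exact: measurable_fun_mem.
  exists N; split=> // w /= nw; apply: contrapT => nN; apply: nw => _.
  by rewrite /g memNset.
rewrite integral_ge0B//.
- rewrite ge0_integralD//; last exact: emeasurable_funM.
  rewrite integral_cst//= [X in (_ * X)%E]probability_setT mule1.
  by rewrite ge0_integralZl_EFin// ltW.
- by move=> w; rewrite u0 (le_lt_trans (u_le w))// ltry.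
- by move=> w; rewrite adde_ge0.
- by apply: le_lt_trans (integral_stopped_reward_le _) _; rewrite ltry.
Qed.

Lemma policy_value_stuck :
  cond H [set w | num_samples Y pi H w = +oo%E] <> 0%E ->
  policy_value Y cond f c al be H pi = -oo%E.
Proof.
move=> ns; rewrite /policy_value ifT// lt0e measure_ge0 andbT.
exact/eqP.
Qed.

Lemma policy_value_le :
  (policy_value Y cond f c al be H pi <= (M * (be - al))%:E)%E.
Proof.
have [ns|ns] := pselect (cond H [set w | num_samples Y pi H w = +oo%E] = 0%E);
  last by rewrite policy_value_stuck// leNye.
rewrite policy_value_stopped//.
have := integral_stopped_reward_le (cond H).
have : (0 <= c%:E * \int[cond H]_w v w)%E.
  by apply: mule_ge0; [rewrite lee_fin ltW|apply: integral_ge0 => w _;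
    exact: v0].
have : (0 <= \int[cond H]_w u w)%E by apply: integral_ge0 => w _; exact: u0.
rewrite /v /u; move: (integral _ _ _) (c%:E * _)%E => [a| |] [b| |] //=.
  by rewrite !lee_fin mulr2n; lra.
by rewrite leNye.
Qed.

End PolicyValue.

Lemma inside_policy_never al be : inside_policy al be (fun=> None).
Proof.
split=> //; apply: is_policyI => // n B mB.
have [B0|nB0] := pselect (B None).
  by rewrite (_ : [set _ | _] = setT)//; apply/seteqP; split.
by rewrite (_ : [set _ | _] = set0)//; apply/seteqP; split.
Qed.

Lemma policy_value_never al be H :
  policy_value Y cond f c al be H (fun=> None) = reward Y cond f al be H.
Proof.
have nsE w : num_samples Y (fun=> None) H w = 0%E /\
    final_history Y (fun=> None) H w = H.
  by have [|//|] := @num_samplesE _ _ _ Y (fun=> None) H 0%N w.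
rewrite /policy_value (_ : [set w | _] = set0).
  rewrite measure0 ltxx.
  transitivity (\int[cond H]_w (cst (reward Y cond f al be H) w))%E.
    apply: eq_integral => w _; have [-> ->] := nsE w.
    by rewrite mule0 sube0.
  by rewrite integral_cst// [X in (_ * X)%E]probability_setT mule1.
by apply/seteqP; split=> w //=; rewrite (nsE w).1.
Qed.

(** The bound is additive because the expected cost may be infinite. Only the cost spent inside the
    interval appears, as the growth of the restricted history. *)
Lemma upper_inside al be H pi (C : R) : 0 <= al -> al <= be -> is_history H ->
  al \in locations H -> be \in locations H -> is_policy pi ->
  cond H [set w | num_samples Y pi H w = +oo%E] = 0%E ->
  0 <= C + M * (be - al) ->
  (forall sigma, inside_policy al be sigma ->
    policy_value Y cond f c al be (restriction al be H) sigma <= C%:E)%E ->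
  (\int[cond H]_w stopped Y pi H
      (fun K => shifted_reward al be (restriction al be K)) w <=
   (C + M * (be - al))%:E + c%:E * \int[cond H]_w stopped Y pi H
      (fun K => extra_card #|` restriction al be H| (restriction al be K)) w)%E.
Proof.
move=> al0 albe HH alH beH ppi ns CL0 sC.
set G := restriction al be H in sC *.
set Fr := (fun K => shifted_reward _ _ _).
set Fc := (fun K => extra_card _ _).
have HG : is_history G by exact: is_history_restriction.
have GE : restriction al be H = restriction al be G by rewrite restriction_id.
have Fr0 K : (0 <= Fr K)%E by exact: shifted_reward_ge0.
have Fc0 K : (0 <= Fc K)%E by exact: extra_card_ge0.
have mFr : history_measurable Fr.
  apply: history_measurable_restriction;
    exact: history_measurable_shifted_reward.
have mFc : history_measurable Fc.
  apply: history_measurable_restriction; exact: history_measurable_extra_card.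
pose Y2 := spliced_process Y al be.
have mY2 : measurable_process Y2 by exact: measurable_spliced_process.
have mS F : (forall K, 0 <= F K)%E -> history_measurable F ->
    measurable_fun [set: T * T] (stopped Y2 pi H F).
  by move=> F0 mF; exact: measurable_stopped.
have cpl F : (forall K, 0 <= F K)%E -> history_measurable F ->
    (\int[cond H]_w stopped Y pi H F w =
     \int[cond G \x cond H]_z stopped Y2 pi H F z)%E.
  move=> F0 mF.
  exact: (coupling_stopped Ymeas Hcond ppi F0 mF HH HG HH alH beH GE).
pose N2 := [set z | num_samples Y2 pi H z = +oo%E].
have mN2 : measurable N2 by exact: measurable_num_samples_pinfty.
have prodN2 : (cond G \x cond H)%E N2 = 0%E.
  have mN : measurable [set w | num_samples Y pi H w = +oo%E].
    exact: measurable_num_samples_pinfty.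
  (* By the coupling with [F = 1], stopping has the same mass under the product law as under
     [cond H]. *)
  have one : (cond G \x cond H)%E (~` N2) = 1%E.
    rewrite -(integral_stopped_cst1 _ mY2 ppi HH) -(cpl (fun=> 1%E)) ?lee01//.
    rewrite integral_stopped_cst1//.
    transitivity (1 - cond H [set w | num_samples Y pi H w = +oo])%E.
      exact: probability_setC.
    by rewrite ns sube0.
  have tot : (cond G \x cond H)%E [set: T * T] = 1%E.
    rewrite -setXTT product_measure1E//.
    by rewrite [X in (X * _)%E]probability_setT [X in (_ * X)%E]probability_setT mule1.
  have : ((cond G \x cond H) (N2 `|` ~` N2) =
      (cond G \x cond H) N2 + (cond G \x cond H) (~` N2))%E.
    by apply: measureU => //; [exact: measurableC|exact: setICr].
  rewrite setUv tot one; case: (_ N2) => [r| |] //.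
  by rewrite -EFinD => -[r1]; congr EFin; lra.
(* [q w'] is the probability that the run never stops when the exterior outcome is [w']. It vanishes
   for almost every [w'], and only for those is a simulated policy compared with [C]. *)
pose q w' := (\int[cond G]_w (\1_N2 (w, w'))%:E)%E.
have m1 : measurable_fun [set: T * T] (fun z => (\1_N2 z)%:E : \bar R).
  exact/measurable_EFinP/measurable_indic.
have q0 : ae_eq (cond H) [set: T] q (cst 0%E).
  apply/ae_eq_integral_abs => //.
    by apply: (measurable_fun_fubini_tonelli_G _ m1) => z; rewrite lee_fin.
  transitivity (\int[cond H]_w' q w')%E.
    apply: eq_integral => w' _; rewrite gee0_abs//.
    by apply: integral_ge0 => w _; rewrite lee_fin.
  rewrite -(fubini_tonelli2 (m1 := cond G) (m2 := cond H) _ m1)//.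
  by rewrite integral_indic// setIT.
rewrite (cpl Fr)// (cpl Fc)//.
rewrite (fubini_tonelli2 _ (mS Fr Fr0 mFr))//; last by move=> z;
  exact: stopped_ge0.
rewrite (fubini_tonelli2 _ (mS Fc Fc0 mFc))//; last by move=> z;
  exact: stopped_ge0.
have mG F : (forall K, 0 <= F K)%E -> history_measurable F ->
    measurable_fun [set: T] (fubini_G (cond G) (stopped Y2 pi H F)).
  move=> F0 mF; apply: measurable_fun_fubini_tonelli_G; first exact: mS.
  by move=> z; exact: stopped_ge0.
have G0 F w' : (forall K, 0 <= F K)%E ->
    (0 <= fubini_G (cond G) (stopped Y2 pi H F) w')%E.
  by move=> F0; apply: integral_ge0 => w _; exact: stopped_ge0.
pose cB w' := (c%:E * fubini_G (cond G) (stopped Y2 pi H Fc) w')%E.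
have cB0 w' : (0 <= cB w')%E.
  by apply: mule_ge0; [rewrite lee_fin ltW|exact: G0].
have mcB : measurable_fun [set: T] cB by apply: emeasurable_funM => //;
  exact: mG.
(* [cond H] has mass one, so the constant moves under the integral and the inequality can be shown
   for almost every [w']. *)
have -> : ((C + M * (be - al))%:E +
   c%:E * \int[cond H]_w' fubini_G (cond G) (stopped Y2 pi H Fc) w' =
   \int[cond H]_w' ((C + M * (be - al))%:E + cB w'))%E.
  rewrite [RHS]ge0_integralD// [X in (_ = X + _)%E]integral_cst//=.
  rewrite [X in (_ = _ * X + _)%E]probability_setT mule1.
  rewrite [X in (_ = _ + X)%E]ge0_integralZl_EFin//; last exact: ltW.
  - by move=> w' _; exact: G0.
  - exact: mG.
apply: ae_ge0_le_integral => //.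
- by move=> w' _; exact: G0.
- exact: mG.
- by move=> w' _; rewrite adde_ge0.
- exact: emeasurable_funD.
apply: filterS q0 => w' /(_ Logic.I) qw' _.
pose sigma := simulated_policy Y al be pi H w'.
have is_sigma : inside_policy al be sigma by exact: simulated_policy_inside.
pose N1 := [set w | N2 (w, w')].
have mN1 : measurable N1.
  have mp : measurable_fun [set: T] (fun w : T => (w, w')).
    exact: measurable_fun_pair.
  by have := mp measurableT _ mN2; rewrite setTI.
have N10 : cond G N1 = 0%E.
  transitivity (\int[cond G]_w (\1_N1 w)%:E)%E;
    first by rewrite integral_indic// setIT.
  exact: qw'.
have good w : ~ N1 w -> exists N K, [/\ pi (sampled_history Y2 pi H N (w, w')) = None,
    K = restriction al be (sampled_history Y2 pi H N (w, w')),
    final_history Y sigma G w = K &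
    num_samples Y sigma G w <> +oo%E].
  move=> /num_samples_finite[N pN].
  have [f1 _ n1] := @simulated_policy_final _ _ _ Y al be pi H w w' ppi HH N pN.
  exists N; exists (restriction al be (sampled_history Y2 pi H N (w, w'))).
  by split=> //; rewrite n1.
(* Outside [N1], the simulated run ends exactly at the restriction of the final spliced history. *)
have transfer (F : {fset R * R} -> \bar R) :
    (forall K, 0 <= F K)%E -> history_measurable F ->
    fubini_G (cond G) (stopped Y2 pi H (fun K => F (restriction al be K))) w' =
    (\int[cond G]_w stopped Y sigma G F w)%E.
  move=> F0 mF; apply: ae_eq_integral => //.
  - apply: (measurable_fun_pair1 (f := stopped Y2 pi H _)); apply: mS => //.
    exact: history_measurable_restriction.
  - by apply: measurable_stopped => //; case: is_sigma.
  exists N1; split=> // w /= nw; apply: contrapT => nN1; apply: nw => _.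
  have [N [K [pN KE fK ns1]]] := good w nN1.
  have [N' sN'] := num_samples_finite ns1.
  by rewrite (stoppedE _ pN) (stopped_final _ sN') fK KE.
have nsig : cond G [set w | num_samples Y sigma G w = +oo%E] = 0%E.
  apply/eqP; rewrite eq_le measure_ge0 andbT -N10; apply: le_measure.
  - rewrite inE; apply: measurable_num_samples_pinfty => //; by case: is_sigma.
  - by rewrite inE.
  by move=> w /= nsw; apply: contrapT => /good[N [K [_ _ _]]].
have := sC _ is_sigma; rewrite policy_value_stopped//; last by case: is_sigma.
rewrite -(transfer _ (shifted_reward_ge0 al be))//; last first.
  exact: history_measurable_shifted_reward.
rewrite -(transfer _ (extra_card_ge0 _))//; last first.
  exact: history_measurable_extra_card.
(* A finite inside cost can be moved to the other side; an infinite one makes the right side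
   [+oo]. *)
rewrite -/Fr -/Fc /cB; have := G0 Fc w' Fc0.
move: (fubini_G (cond G) (stopped Y2 pi H Fc) w') => [b| |] // b0.
  by rewrite -EFinM leeBlDr// => /le_trans; apply; rewrite -!EFinD lee_fin; lra.
by move=> _; rewrite gt0_muley ?lte_fin// leey.
Qed.

End Values.

(** * Splitting an interval *)

Section RestrictionCards.
Context {R : realType}.
Implicit Types (H K : {fset R * R}) (al be s : R).

Lemma restrictionS al be H K : (H `<=` K)%fset ->
  (restriction al be H `<=` restriction al be K)%fset.
Proof.
move=> /fsubsetP HK; apply/fsubsetP => p; rewrite !in_restriction.
by move=> /andP[/HK -> ->].
Qed.

(** The only location common to both intervals is [s], which is observed in [H], so the two sets of
    new observations are disjoint. Equality may fail because [K] may also grow outside both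
    intervals. *)
Lemma card_restriction_split al s be H K : is_history K -> (H `<=` K)%fset ->
  s \in locations H ->
  ((#|` restriction al s K| - #|` restriction al s H|) +
   (#|` restriction s be K| - #|` restriction s be H|) <= #|` K| - #|` H|)%N.
Proof.
move=> [_ Kfun] HK sH.
pose D al be := (restriction al be K `\` restriction al be H)%fset.
have cD (A B : {fset R * R}) : (B `<=` A)%fset ->
    #|` (A `\` B)%fset| = (#|` A| - #|` B|)%N.
  by move=> /fsetIidPr AB; rewrite cardfsD AB.
rewrite -!cD ?restrictionS// -/(D al s) -/(D s be).
have D0 : (D al s `&` D s be = fset0)%fset.
  apply/fsetP => p; rewrite /D !inE; apply/negP.
  move=> /andP[/andP[nH /andP[pK /andP[alp ps]]] /andP[_ /andP[_ /andP[sp _]]]].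
  have psE : p.1 = s by apply/eqP; rewrite eq_le ps.
  have /locationsP[y syH] := sH.
  have pE : p = (s, y).
    rewrite [p]surjective_pairing psE; congr pair.
    by apply: (Kfun p (s, y)) => //; exact: (fsubsetP HK).
  by move: nH; rewrite pE syH /= -{1}psE alp lexx.
rewrite -cardfsUI D0 cardfs0 addn0.
apply: fsubset_leq_card; apply/fsubsetP => p; rewrite /D !inE.
case/orP => /andP[nH /andP[-> pJ]]; rewrite andbT;
  by apply: contra nH => ->.
Qed.

End RestrictionCards.

Section ErealValues.
Context {R : realType}.
Local Open Scope ereal_scope.
Variable c : R.
Hypothesis c0 : (0 < c)%R.

(** Turns the additive bounds back into a bound on reward minus cost; if [B] is infinite the left
    side is [-oo]. *)
Lemma ereal_value_le (A A' B B' : \bar R) (r L : R) :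
  0 <= B' -> A <= A' -> B' <= B -> A' <= (r + L)%:E + c%:E * B' ->
  A - (L%:E + c%:E * B) <= r%:E.
Proof.
move=> B0 AA BB AB; have {AA AB} := le_trans AA AB.
case: B BB => [b| |] BB.
- case: B' B0 BB => [b'| |] //; rewrite !lee_fin => _ bb.
  rewrite -!EFinM -!EFinD leeBlDr// => /le_trans; apply.
  by rewrite -EFinD lee_fin; have := ler_wpM2l (ltW c0) bb; lra.
- by rewrite gt0_muley ?lte_fin// addey// addeNy leNye.
- by move: (le_trans B0 BB).
Qed.

Lemma ereal_valueD (A1 A2 B1 B2 : \bar R) (L1 L2 : R) :
  0 <= A1 < +oo -> 0 <= A2 < +oo -> 0 <= B1 -> 0 <= B2 ->
  (A1 - (L1%:E + c%:E * B1)) + (A2 - (L2%:E + c%:E * B2)) =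
  (A1 + A2) - ((L1 + L2)%:E + c%:E * (B1 + B2)).
Proof.
case: A1 => [a1| |]; [|by rewrite ltxx andbF|by []] => _.
case: A2 => [a2| |]; [|by rewrite ltxx andbF|by []] => _.
case: B1 => [b1| |] // _; case: B2 => [b2| |] // _;
  rewrite ?addye ?addey// ?gt0_muley ?lte_fin// ?addey// ?addeNy ?addNye//.
by rewrite -!EFinM -!EFinD; congr EFin; lra.
Qed.

End ErealValues.

Section Split.
Context {d} {T : measurableType d} {R : realType}.
Variables (P : probability T R) (Y : R -> T -> R).
Variable cond : {fset R * R} -> probability T R.
Variables (I : finType) (f : I -> R -> R) (M c : R).
Hypothesis Ymeas : measurable_process Y.
Hypothesis Hcond : conditional_laws P Y cond.
Hypothesis I0 : (0 < #|I|)%N.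
Hypothesis fmeas : forall i, measurable_fun [set: R] (f i).
Hypothesis fM : forall i z, `|f i z| <= M.
Hypothesis c0 : 0 < c.
Implicit Types (H K G : {fset R * R}) (x al be s : R).
Implicit Types (pi sigma : {fset R * R} -> option R).

Let rho := shifted_reward Y cond f M.
Let pv := policy_value Y cond f c.

Let rho0 al be K : (0 <= rho al be K)%E.
Proof. exact: shifted_reward_ge0. Qed.

Let mrho al be : 0 <= al -> history_measurable (rho al be).
Proof. exact: (history_measurable_shifted_reward M Ymeas Hcond fmeas be). Qed.

Let pvE := policy_value_stopped Ymeas Hcond I0 fmeas fM c0.
Let pv_stuck := @policy_value_stuck _ T R Y cond I f c.

Definition inside_value al be G : \bar R :=
  ereal_sup [set pv al be G sigma | sigma in inside_policy al be].

(** The policy that never samples gives the lower bound. Finiteness is what later allows these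
    suprema to be moved across inequalities. *)
Lemma inside_value_bounds al be G : 0 <= al -> al <= be -> is_history G ->
  exists2 r : R, inside_value al be G = r%:E & 0 <= r + M * (be - al).
Proof.
move=> al0 albe HG.
have [r rE /andP[r1 _]] := reward_bounds Ymeas Hcond I0 fmeas fM HG al0 albe.
have lo : (r%:E <= inside_value al be G)%E.
  apply: ereal_sup_ubound; exists (fun=> None);
    first exact: inside_policy_never.
  by rewrite /pv policy_value_never.
have hi : (inside_value al be G <= (M * (be - al))%:E)%E.
  apply: ge_ereal_sup => _ [sigma [psigma _] <-].
  exact: (policy_value_le Ymeas Hcond I0 fmeas fM c0 al0 albe HG psigma).
move: lo hi; case: (inside_value al be G) => [v| |] //.
by rewrite !lee_fin => rv _; exists v => //; lra.
Qed.

Let upper al be H pi : 0 <= al -> al <= be -> is_history H ->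
  al \in locations H -> be \in locations H -> is_policy pi ->
  cond H [set w | num_samples Y pi H w = +oo%E] = 0%E ->
  exists2 r : R, inside_value al be (restriction al be H) = r%:E &
  (\int[cond H]_w stopped Y pi H (fun K => rho al be (restriction al be K)) w <=
   (r + M * (be - al))%:E + c%:E * \int[cond H]_w stopped Y pi H
      (fun K => extra_card #|` restriction al be H| (restriction al be K)) w)%E.
Proof.
move=> al0 albe HH alH beH ppi ns.
have HG := is_history_restriction al be HH.
have [r rE r0] := inside_value_bounds al0 albe HG.
exists r => //; apply: (upper_inside Ymeas Hcond I0 fmeas fM c0) => //.
by move=> sigma ss; rewrite -rE; apply: ereal_sup_ubound; exists sigma.
Qed.

Let stopped_ge0I mu pi H F : (forall K, 0 <= F K)%E ->
  (0 <= \int[mu : probability T R]_w stopped Y pi H F w)%E.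
Proof. by move=> F0; apply: integral_ge0 => w _; exact: stopped_ge0. Qed.

Let mstopped pi H F : is_policy pi -> is_history H ->
  (forall K, 0 <= F K)%E -> history_measurable F ->
  measurable_fun [set: T] (stopped Y pi H F).
Proof. by move=> ppi HH F0 mF; exact: measurable_stopped. Qed.

Let mcount m : history_measurable (@extra_card R m).
Proof. exact: history_measurable_extra_card. Qed.

Let mrestr al be F : history_measurable F ->
  history_measurable (fun K => F (restriction al be K : {fset R * R})).
Proof. exact: history_measurable_restriction. Qed.

(** From [G] an arbitrary policy gains nothing by leaving the interval: dropping the observations
    made outside keeps the reward and does not increase the cost. *)
Lemma value_restriction al be H : 0 <= al -> al <= be -> is_history H ->
  al \in locations H -> be \in locations H ->
  value Y cond f c al be (restriction al be H) =
  inside_value al be (restriction al be H).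
Proof.
move=> al0 albe HH alH beH; set G := restriction al be H.
have HG : is_history G by exact: is_history_restriction.
have alG : al \in locations G by rewrite locations_restriction alH lexx.
have beG : be \in locations G by rewrite locations_restriction beH lexx albe.
apply/eqP; rewrite eq_le; apply/andP; split; last first.
  by apply: le_ereal_sup => _ [sigma [psigma _] <-]; exists sigma.
apply: ge_ereal_sup => _ [pi ppi <-].
have [ns|ns] := pselect (cond G [set w | num_samples Y pi G w = +oo%E] = 0%E);
  last by rewrite pv_stuck// leNye.
rewrite (pvE al0 albe HG ppi ns).
have [r] := upper al0 albe HG alG beG ppi ns.
rewrite restriction_id -/G => -> U.
have A_le : (\int[cond G]_w stopped Y pi G (rho al be) w <=
    \int[cond G]_w stopped Y pi G (fun K => rho al be (restriction al be K)) w)%E.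
  apply: ge0_le_integral => //.
  - by move=> w _; exact: stopped_ge0.
  - by apply: mstopped => //; exact: mrho.
  - by apply: mstopped => //; apply: mrestr; exact: mrho.
  move=> w _; apply: le_stopped => // n Hn GHn.
  have alHn := locationsS GHn alG; have beHn := locationsS GHn beG.
  rewrite /rho !(shifted_rewardE Ymeas Hcond I0 fmeas fM)//;
    last exact: is_history_restriction.
  by rewrite (reward_restriction Ymeas Hcond).
have B_le : (\int[cond G]_w stopped Y pi G
      (fun K => extra_card #|` G| (restriction al be K)) w <=
    \int[cond G]_w stopped Y pi G (extra_card #|` G|) w)%E.
  apply: ge0_le_integral => //.
  - by move=> w _; apply: stopped_ge0 => K; exact: extra_card_ge0.
  - apply: mstopped => //; first by move=> K; exact: extra_card_ge0.
    by apply: mrestr; exact: mcount.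
  - by apply: mstopped => //; exact: extra_card_ge0.
  move=> w _; apply: le_stopped => // [|n Hn GHn]; first exact: extra_card_ge0.
  have GGn : (G `<=` restriction al be (sampled_history Y pi G n w))%fset.
    by have := restrictionS al be GHn; rewrite {1}/G restriction_id.
  rewrite !extra_cardE ?fsubset_leq_card// lee_fin lerD2r ler_nat.
  by apply: fsubset_leq_card; exact: restriction_sub.
apply: (ereal_value_le c0 _ A_le B_le U).
by apply: stopped_ge0I => K; exact: extra_card_ge0.
Qed.

Lemma num_samples_stopped pi H w : num_samples Y pi H w <> +oo%E ->
  stopped Y pi H (extra_card #|` H|) w = num_samples Y pi H w.
Proof.
move=> /num_samples_finite[N pN]; rewrite (stopped_final _ pN).
by have [-> le ->] := final_historyE pN; rewrite extra_cardE.
Qed.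

Lemma shifted_reward_split al s be K : 0 <= al -> al <= s -> s <= be ->
  is_history K -> al \in locations K -> s \in locations K ->
  be \in locations K ->
  rho al be K =
  (rho al s (restriction al s K) + rho s be (restriction s be K))%E.
Proof.
move=> al0 als sbe HK alK sK beK.
have s0 : 0 <= s := le_trans al0 als; have albe : al <= be := le_trans als sbe.
rewrite /rho !(shifted_rewardE Ymeas Hcond I0 fmeas fM)//;
  [|exact: is_history_restriction|exact: is_history_restriction].
rewrite -(reward_restriction Ymeas Hcond _ HK alK sK)//.
rewrite -(reward_restriction Ymeas Hcond _ HK sK beK)//.
rewrite (reward_split Ymeas Hcond _ HK al0 als sbe)//.
have [q1 -> _] := reward_bounds Ymeas Hcond I0 fmeas fM HK al0 als.
have [q2 -> _] := reward_bounds Ymeas Hcond I0 fmeas fM HK s0 sbe.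
by rewrite -!EFinD; congr EFin; lra.
Qed.

(** One run of [pi] is bounded on each piece separately. The reward splits exactly, while the costs
    on the pieces add up to at most the total cost. *)
Let value_split_le al s be H pi : 0 <= al -> al <= s -> s <= be ->
  is_history H -> al \in locations H -> s \in locations H ->
  be \in locations H -> is_policy pi ->
  (pv al be H pi <= inside_value al s (restriction al s H) +
                    inside_value s be (restriction s be H))%E.
Proof.
move=> al0 als sbe HH alH sH beH ppi.
have s0 : 0 <= s := le_trans al0 als; have albe : al <= be := le_trans als sbe.
have [ns|ns] := pselect (cond H [set w | num_samples Y pi H w = +oo%E] = 0%E);
  last by rewrite /pv pv_stuck// leNye.
rewrite /pv (pvE al0 albe HH ppi ns).
have [r1 -> U1] := upper al0 als HH alH sH ppi ns.
have [r2 -> U2] := upper s0 sbe HH sH beH ppi ns.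
pose G1 := restriction al s H; pose G2 := restriction s be H.
pose F1 K := rho al s (restriction al s K).
pose F2 K := rho s be (restriction s be K).
pose E1 K := extra_card #|` G1| (restriction al s K).
pose E2 K := extra_card #|` G2| (restriction s be K).
have F10 K : (0 <= F1 K)%E by exact: rho0.
have F20 K : (0 <= F2 K)%E by exact: rho0.
have E10 K : (0 <= E1 K)%E by exact: extra_card_ge0.
have E20 K : (0 <= E2 K)%E by exact: extra_card_ge0.
have mF1 : history_measurable F1 by apply: mrestr; exact: mrho.
have mF2 : history_measurable F2 by apply: mrestr; exact: mrho.
have mE1 : history_measurable E1 by apply: mrestr; exact: mcount.
have mE2 : history_measurable E2 by apply: mrestr; exact: mcount.
have A_le : (\int[cond H]_w stopped Y pi H (rho al be) w <=
    \int[cond H]_w stopped Y pi H F1 w + \int[cond H]_w stopped Y pi H F2 w)%E.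
  rewrite -ge0_integralD//; [|by move=> w _; exact: stopped_ge0|exact: mstopped|
    by move=> w _; exact: stopped_ge0|exact: mstopped].
  apply: ge0_le_integral => //.
  - by move=> w _; exact: stopped_ge0.
  - by apply: mstopped => //; exact: mrho.
  - by apply: emeasurable_funD; exact: mstopped.
  move=> w _; rewrite -stoppedD; apply: le_stopped => // [K|n Hn GHn].
    exact: adde_ge0.
  have alHn := locationsS GHn alH; have sHn := locationsS GHn sH.
  have beHn := locationsS GHn beH.
  by rewrite (@shifted_reward_split al s be).
have B_le : (\int[cond H]_w stopped Y pi H E1 w + \int[cond H]_w stopped Y pi H E2 w
    <= \int[cond H]_w stopped Y pi H (extra_card #|` H|) w)%E.
  rewrite -ge0_integralD//; [|by move=> w _; exact: stopped_ge0|exact: mstopped|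
    by move=> w _; exact: stopped_ge0|exact: mstopped].
  apply: ge0_le_integral => //.
  - by move=> w _; apply: adde_ge0; exact: stopped_ge0.
  - by apply: emeasurable_funD; exact: mstopped.
  - by apply: mstopped => //; exact: extra_card_ge0.
  move=> w _; rewrite -stoppedD; apply: le_stopped => // [|n Hn GHn].
    exact: extra_card_ge0.
  rewrite /E1 /E2 !extra_cardE ?fsubset_leq_card ?restrictionS//.
  rewrite -EFinD lee_fin -!natrB ?fsubset_leq_card ?restrictionS//.
  by rewrite -natrD ler_nat; exact: card_restriction_split.
rewrite -EFinD; apply: (ereal_value_le c0 _ A_le B_le).
  by apply: adde_ge0; exact: stopped_ge0I.
apply: le_trans (leeD U1 U2) _.
rewrite -/F1 -/F2 -/E1 -/E2 addeACA -EFinD (ge0_muleDr _ (stopped_ge0I _ _ _ E10) (stopped_ge0I _ _ _ E20)).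
by rewrite leeD2r// lee_fin; lra.
Qed.

(** The coupling is applied to the run from [G], with [cond H] for the inside and [cond G] for the
    outside; the policy never reads the second outcome, which integrates out. *)
Lemma inside_transfer al be H sigma F : is_history H ->
  al \in locations H -> be \in locations H -> al <= be ->
  inside_policy al be sigma -> (forall K, 0 <= F K)%E -> history_measurable F ->
  (\int[cond (restriction al be H)]_w stopped Y sigma (restriction al be H) F w =
   \int[cond H]_w stopped Y sigma (restriction al be H) F w)%E.
Proof.
move=> HH alH beH albe [psigma insigma] F0 mF; set G := restriction al be H.
have HG : is_history G by exact: is_history_restriction.
have alG : al \in locations G by rewrite locations_restriction alH lexx.
have beG : be \in locations G by rewrite locations_restriction beH lexx albe.
have GE : restriction al be G = restriction al be H by rewrite restriction_id.
rewrite (coupling_stopped Ymeas Hcond psigma F0 mF HG HH HG alG beG GE (erefl _)).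
have runE n z : sampled_history (spliced_process Y al be) sigma G n z =
    sampled_history Y sigma G n z.1.
  elim: n => [//|n IH] /=; rewrite IH; case E: (sigma _) => [x|//].
  by have [xJ _] := insigma _ _ E; rewrite /spliced_process xJ.
rewrite fubini_tonelli1//; last 2 first.
- by apply: measurable_stopped => //; exact: measurable_spliced_process.
- by move=> z; exact: stopped_ge0.
apply: eq_integral => w _; rewrite /fubini_F.
transitivity (\int[cond G]_w' (cst (stopped Y sigma G F w) w'))%E.
  apply: eq_integral => w' _ /=; congr (limn _); apply/funext => n.
  by rewrite runE.
by rewrite integral_cst// [X in (_ * X)%E]probability_setT mule1.
Qed.

Lemma probability_setC_eq1 (mu : probability T R) (A : set T) : measurable A ->
  mu A = 0%E <-> mu (~` A) = 1%E.
Proof.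
move=> mA; rewrite probability_setC//; split=> [->|]; first by rewrite sube0.
have := measure_ge0 mu A; have := probability_le1 mu mA.
by case: (mu A) => [r| |] //= _ _ [r1]; congr EFin; lra.
Qed.

Let value_split_ge al s be H sigma1 sigma2 : 0 <= al -> al <= s -> s <= be ->
  is_history H -> al \in locations H -> s \in locations H ->
  be \in locations H ->
  inside_policy al s sigma1 -> inside_policy s be sigma2 ->
  (pv al s (restriction al s H) sigma1 + pv s be (restriction s be H) sigma2 <=
   value Y cond f c al be H)%E.
Proof.
move=> al0 als sbe HH alH sH beH in1 in2.
have s0 : 0 <= s := le_trans al0 als; have albe : al <= be := le_trans als sbe.
set G1 := restriction al s H; set G2 := restriction s be H.
have HG1 : is_history G1 by exact: is_history_restriction.
have HG2 : is_history G2 by exact: is_history_restriction.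
have p1 := in1.1; have p2 := in2.1.
pose N1 := [set w | num_samples Y sigma1 G1 w = +oo%E].
pose N2 := [set w | num_samples Y sigma2 G2 w = +oo%E].
have mN1 : measurable N1 by exact: measurable_num_samples_pinfty.
have mN2 : measurable N2 by exact: measurable_num_samples_pinfty.
have [n1|n1] := pselect (cond G1 N1 = 0%E);
  last by rewrite /pv pv_stuck// addNye leNye.
have [n2|n2] := pselect (cond G2 N2 = 0%E);
  last by rewrite /pv [X in (_ + X)%E]pv_stuck// addeNy leNye.
(* The combined policy runs under [cond H], so almost sure stopping has to be carried over from
   [cond G]. *)
have null al' be' sigma : al' \in locations H -> be' \in locations H ->
    al' <= be' -> inside_policy al' be' sigma ->
    let G := restriction al' be' H in
    cond G [set w | num_samples Y sigma G w = +oo%E] = 0%E ->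
    cond H [set w | num_samples Y sigma G w = +oo%E] = 0%E.
  move=> alH' beH' albe' ins G.
  have HG : is_history G by exact: is_history_restriction.
  have mN : measurable [set w | num_samples Y sigma G w = +oo%E].
    by apply: measurable_num_samples_pinfty => //; case: ins.
  move=> /(probability_setC_eq1 _ mN) n; apply/(probability_setC_eq1 _ mN).
  rewrite -n -!integral_stopped_cst1//; try by case: ins.
  by rewrite (inside_transfer HH alH' beH' albe' ins)//;
    exact: history_measurable_cst.
have {}null1 : cond H N1 = 0%E by exact: null.
have {}null2 : cond H N2 = 0%E by exact: null.
have mN : measurable (N1 `|` N2) by exact: measurableU.
have nullU : cond H (N1 `|` N2) = 0%E by rewrite measureU0.
pose pi := combined_policy al s be sigma1 sigma2.
have ppi : is_policy pi by exact: combined_policyP.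
have good w : ~ (N1 `|` N2) w -> exists n, let h := sampled_history Y pi H n w in
    [/\ pi h = None, final_history Y sigma1 G1 w = restriction al s h,
        final_history Y sigma2 G2 w = restriction s be h &
        num_samples Y pi H w = (num_samples Y sigma1 G1 w + num_samples Y sigma2 G2 w)%E].
  move=> /not_orP[/num_samples_finite[n1' s1] /num_samples_finite[n2' s2]].
  have [n pn [f1 f2 _ ns]] := combined_policy_final sH in1 in2 s1 s2.
  by exists n.
have npi : cond H [set w | num_samples Y pi H w = +oo%E] = 0%E.
  apply/eqP; rewrite eq_le measure_ge0 andbT -nullU; apply: le_measure.
  - by rewrite inE; exact: measurable_num_samples_pinfty.
  - by rewrite inE.
  move=> w /= nsw; apply: contrapT => /good[n [pn _ _ _]].
  exact: num_samples_stop pn nsw.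
have ae_eqU (u v : T -> \bar R) : measurable_fun [set: T] u ->
    measurable_fun [set: T] v -> (forall w, ~ (N1 `|` N2) w -> u w = v w) ->
    (\int[cond H]_w u w = \int[cond H]_w v w)%E.
  move=> mu mv uv; apply: ae_eq_integral => //.
  exists (N1 `|` N2); split=> // w /= nw; apply: contrapT => nN; apply: nw => _.
  exact: uv.
pose E1 := extra_card (R := R) #|` G1|; pose E2 := extra_card (R := R) #|` G2|.
have E0 m K : (0 <= @extra_card R m K)%E by exact: extra_card_ge0.
have AE : (\int[cond H]_w stopped Y pi H (rho al be) w =
    \int[cond H]_w stopped Y sigma1 G1 (rho al s) w +
    \int[cond H]_w stopped Y sigma2 G2 (rho s be) w)%E.
  have ms1 : measurable_fun [set: T] (stopped Y sigma1 G1 (rho al s)).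
    by apply: mstopped => //; exact: mrho.
  have ms2 : measurable_fun [set: T] (stopped Y sigma2 G2 (rho s be)).
    by apply: mstopped => //; exact: mrho.
  rewrite -ge0_integralD//; [|by move=> w _; exact: stopped_ge0..].
  apply: ae_eqU; [by apply: mstopped => //;
    exact: mrho|exact: emeasurable_funD|].
  move=> w nw; have [n [pn f1 f2 _]] := good w nw.
  move/not_orP: nw => [/num_samples_finite[n1' s1] /num_samples_finite[n2' s2]].
  rewrite (stoppedE _ pn) (stopped_final _ s1) (stopped_final _ s2) f1 f2.
  have Hn : is_history (sampled_history Y pi H n w) by exact: is_history_sampled.
  have GHn := sampled_history_sub Y pi H w (leq0n n).
  have alHn := locationsS GHn alH; have sHn := locationsS GHn sH.
  have beHn := locationsS GHn beH.
  by rewrite (@shifted_reward_split al s be).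
have BE : (\int[cond H]_w stopped Y pi H (extra_card #|` H|) w =
    \int[cond H]_w stopped Y sigma1 G1 E1 w +
    \int[cond H]_w stopped Y sigma2 G2 E2 w)%E.
  have ms1 : measurable_fun [set: T] (stopped Y sigma1 G1 E1).
    exact: (mstopped p1 HG1 (E0 _) (mcount _)).
  have ms2 : measurable_fun [set: T] (stopped Y sigma2 G2 E2).
    exact: (mstopped p2 HG2 (E0 _) (mcount _)).
  rewrite -ge0_integralD//; [|by move=> w _; apply: stopped_ge0 => K;
    exact: E0..].
  apply: ae_eqU; [exact: (mstopped ppi HH (E0 _) (mcount _))|exact: emeasurable_funD|].
  move=> w nw; have [n [pn _ _ ns]] := good w nw; move/not_orP: nw => [nw1 nw2].
  rewrite num_samples_stopped; last exact: num_samples_stop pn.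
  by rewrite ns !num_samples_stopped.
(* Once both separate runs are transferred to [cond H], rewards and costs add up outcome by outcome
   off a null set. *)
have -> : (pv al s G1 sigma1 + pv s be G2 sigma2 = pv al be H pi)%E.
  rewrite /pv (pvE al0 als HG1 p1 n1) (pvE s0 sbe HG2 p2 n2) (pvE al0 albe HH ppi npi).
  rewrite -/(rho _ _) -/(rho _ _) -/(rho _ _) AE BE.
  rewrite !(inside_transfer HH alH sH als in1)//; last exact: mrho.
  rewrite !(inside_transfer HH sH beH sbe in2)//; last exact: mrho.
  rewrite ereal_valueD//.
  - by congr (_ - (_%:E + _))%E; lra.
  - rewrite stopped_ge0I//=; apply: le_lt_trans (ltry _).
    exact: (integral_stopped_reward_le Ymeas Hcond I0 fmeas fM al0 als HG1 p1).
  - rewrite stopped_ge0I//=; apply: le_lt_trans (ltry _).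
    exact: (integral_stopped_reward_le Ymeas Hcond I0 fmeas fM s0 sbe HG2 p2).
  - exact: stopped_ge0I.
  - exact: stopped_ge0I.
by apply: ereal_sup_ubound; exists pi.
Qed.

Lemma value_split al s be H : 0 <= al -> al <= s -> s <= be ->
  is_history H -> al \in locations H -> s \in locations H ->
  be \in locations H ->
  value Y cond f c al be H =
  (value Y cond f c al s (restriction al s H) +
   value Y cond f c s be (restriction s be H))%E.
Proof.
move=> al0 als sbe HH alH sH beH; have s0 : 0 <= s := le_trans al0 als.
rewrite !value_restriction//; apply/eqP; rewrite eq_le; apply/andP; split.
  by apply: ge_ereal_sup => _ [pi ppi <-]; exact: value_split_le.
have [r1 r1E _] := inside_value_bounds al0 als (is_history_restriction al s HH).
have [r2 r2E _] := inside_value_bounds s0 sbe (is_history_restriction s be HH).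
set V := value Y cond f c al be H.
have pvlt al' be' G sigma : 0 <= al' -> al' <= be' -> is_history G ->
    inside_policy al' be' sigma -> (pv al' be' G sigma < +oo)%E.
  move=> al0' albe' HG [psigma _]; apply: le_lt_trans (ltry _).
  exact: (policy_value_le Ymeas Hcond I0 fmeas fM c0 al0' albe' HG psigma).
(* The supremum is taken over one policy at a time; a value [-oo] is set apart, since it cannot be
   moved across the inequality. *)
have sup1 sigma2 : inside_policy s be sigma2 ->
    (inside_value al s (restriction al s H) +
     pv s be (restriction s be H) sigma2 <= V)%E.
  move=> in2; have := pvlt _ _ _ _ s0 sbe (is_history_restriction s be HH) in2.
  case E2: (pv s be _ sigma2) => [v2| |] // _; last by rewrite addeNy leNye.
  rewrite -leeBrDr//; apply: ge_ereal_sup => _ [sigma1 in1 <-].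
  by rewrite leeBrDr// -E2; exact: value_split_ge.
rewrite addeC r1E -leeBrDr//; apply: ge_ereal_sup => _ [sigma2 in2 <-].
by rewrite leeBrDr// addeC -r1E; exact: sup1.
Qed.

Lemma value_point al H : 0 <= al -> is_history H ->
  value Y cond f c al al H = 0%E.
Proof.
move=> al0 HH; apply/eqP; rewrite eq_le; apply/andP; split.
  apply: ge_ereal_sup => _ [pi ppi <-].
  have := policy_value_le Ymeas Hcond I0 fmeas fM c0 al0 (lexx al) HH ppi.
  by rewrite subrr mulr0.
apply: ereal_sup_ubound; exists (fun=> None).
  by case: (@inside_policy_never R al al).
by rewrite policy_value_never /reward set_itv1 integral_set1.
Qed.

(** The last gap is split off, and the induction hypothesis is applied to the restriction to the
    rest, which is why [H] varies. Restricting that further to one of its gaps is the same as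
    restricting [H] directly. *)
Lemma value_sum (x : nat -> R) n H : 0 <= x 0%N -> is_history H ->
  (forall i j, (i < j)%N -> (j <= n)%N -> x i < x j) ->
  (forall i, (i <= n)%N -> x i \in locations H) ->
  value Y cond f c (x 0%N) (x n) H =
  (\sum_(i < n) value Y cond f c (x i) (x i.+1) (restriction (x i) (x i.+1) H))%E.
Proof.
move=> x0; elim: n H => [|n IH] H HH xlt xH.
  by rewrite big_ord0 value_point.
have xle i j : (i <= j)%N -> (j <= n.+1)%N -> x i <= x j.
  by rewrite leq_eqVlt => /orP[/eqP->//|ij] jn; apply/ltW/xlt.
rewrite (@value_split _ (x n))//; [|exact: xle|exact: xle|exact: xH..].
rewrite IH ?big_ord_recr//=.
- congr (_ + _)%E; apply: eq_bigr => i _; congr value.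
  apply/fsetP => p; rewrite !in_restriction -andbA; congr (_ && _).
  apply/idP/idP => [/andP[_ ->]//|/andP[xip pxi]].
  rewrite xip pxi (le_trans (xle 0%N i _ _) xip) ?(leq_trans (ltnW (ltn_ord i)))//=.
  by rewrite andbT (le_trans pxi)//; apply: xle.
- exact: is_history_restriction.
- by move=> i j ij jn; apply: xlt => //; exact: leqW.
- by move=> i i_n; rewrite locations_restriction xH ?leqW// !xle// leqW.
Qed.

End Split.

(** * Decomposition along the gaps between consecutive observations *)

Theorem theorem1 (R : realType) (d : measure_display) (T : measurableType d)
    (P : probability T R) (Y : R -> T -> R)
    (cond : {fset R * R} -> probability T R)
    (I : finType) (f : I -> R -> R) (a b c : R)
    (H : {fset R * R}) (t : nat) (x y : nat -> R)
    (Ymeas : measurable_process Y)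
    (Ymarkov : markov_process P Y)
    (Hcond : conditional_laws P Y cond)
    (I0 : (0 < #|I|)%N)
    (fmeas : forall i, measurable_fun [set: R] (f i))
    (fbnd : forall i, exists M : R, forall z, `|f i z| <= M)
    (fint : forall i,
      (\int[lebesgue_measure]_(u in `[a, b])
         'E_P[fun w => (`|f i (Y u w)|)%R] < +oo)%E)
    (a0 : 0 < a) (ab : a < b) (c0 : 0 < c)
    (Hhist : is_history H)
    (Ha : a \in locations H) (Hb : b \in locations H)
    (xincr : forall i j : nat, (i < j)%N -> (j < t.+2)%N -> x i < x j)
    (Hxy : forall p : R * R, (p \in H /\ a <= p.1 <= b) <->
      exists2 i : nat, (i < t.+2)%N & p = (x i, y i)) :
  value Y cond f c a b H =
  (\sum_(i < t.+1)
     value Y cond f c (x i) (x i.+1)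
       [fset (x i, y i); (x i.+1, y i.+1)]%fset)%E.
Proof.
have [B fB] := choice fbnd.
(* A bound common to all [i]: the sum dominates each single bound. *)
have fM i z : `|f i z| <= \sum_j `|B j|.
  apply: le_trans (fB i z) (le_trans (ler_norm _) _).
  by rewrite (bigD1 i)//= lerDl sumr_ge0.
have xyH i : (i < t.+2)%N -> (x i, y i) \in H /\ a <= x i <= b.
  by move=> it; apply/Hxy; exists i.
have xle i j : (i <= j)%N -> (j < t.+2)%N -> x i <= x j.
  by rewrite leq_eqVlt => /orP[/eqP->//|ij] jt; apply/ltW/xincr.
have at_x z : z \in locations H -> a <= z <= b -> exists2 i, (i < t.+2)%N & z = x i.
  move=> /locationsP[v zvH] zab.
  by have [i it [-> _]] := (Hxy (z, v)).1 (conj zvH zab); exists i.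
(* [a] is observed, hence is some [x i], and [x 0] is the least of these while lying in [[a, b]]. *)
have ax : a = x 0%N.
  have [i it ai] := at_x a Ha (introT andP (conj (lexx a) (ltW ab))).
  apply/eqP; rewrite eq_le; apply/andP; split; last by rewrite ai xle.
  by have [_ /andP[]] := xyH 0%N isT.
have bx : b = x t.+1.
  have [i it bi] := at_x b Hb (introT andP (conj (ltW ab) (lexx b))).
  apply/eqP; rewrite eq_le; apply/andP; split; first by rewrite bi xle.
  by have [_ /andP[]] := xyH t.+1 (ltnSn _).
rewrite {1}ax {1}bx (value_sum Ymeas Hcond I0 fmeas fM c0)//.
- apply: eq_bigr => i _; congr value.
  have it : (i.+1 < t.+2)%N by rewrite ltnS.
  have it' : (i < t.+2)%N by exact: ltnW.
  (* No observation lies strictly between [x i] and [x i.+1]: its index would lie strictly between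
     [i] and [i.+1]. *)
  apply/fsetP => p; rewrite in_restriction !inE; apply/andP/orP.
    move=> [pH /andP[xip pxi]].
    have [j jt pE] : exists2 j, (j < t.+2)%N & p = (x j, y j).
      apply/Hxy; split=> //; rewrite {1}ax {1}bx.
      by rewrite (le_trans (xle 0%N i _ _) xip)// (le_trans pxi)// xle.
    move: xip pxi; rewrite pE /= => xij xji.
    have ij : (i <= j)%N.
      by rewrite leqNgt; apply/negP => /xincr -/(_ it'); rewrite ltNge xij.
    have ji : (j <= i.+1)%N.
      by rewrite leqNgt; apply/negP => /xincr -/(_ jt); rewrite ltNge xji.
    move: ji; rewrite leq_eqVlt => /orP[/eqP->|ji]; [by right|left].
    by have -> : j = i by apply/eqP; rewrite eqn_leq ij -ltnS ji.
  case=> /eqP-> /=; first by rewrite lexx xle// (xyH i it').1.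
  by rewrite lexx xle// (xyH i.+1 it).1.
- by rewrite -ax ltW.
- by move=> i it; exact: locations_mem (xyH i it).1.
Qed.
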